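(* Assume that $\sigma$ satisfies condition (SY). Then, for $1\le k\le n-1$, $$(n-k)\,\partial_s^k(\rho)|_0=-\partial_s^k\Big(\frac{\mathring{v}'}{\mathring{v}}\Big)\Big|_0+2\sum_{j=1}^kj\binom{k}{j}\,\partial_s^{j-1}(\rho)|_0\;\partial_s^{k-j}\Big(\frac{\mathring{v}'}{\mathring{v}}\Big)\Big|_0-k\,\partial_s^{k-1}(\mathsf{J})|_0 .$$
   Context: Setting: $(X,g)$ is a compact Riemannian manifold of dimension $n+1$ with boundary $M$ (of dimension $n$), $\iota:M\hookrightarrow X$ the inclusion, $h=\iota^*(g)$. A boundary defining function is $\sigma\in C^\infty(X)$ (smooth up to the boundary) with $\sigma^{-1}(0)=M$, $\sigma>0$ on $X\setminus M$, $d\sigma|_M\neq0$. $\Delta_g=\operatorname{div}\operatorname{grad}$. Put $2n\,\mathsf{J}=\operatorname{scal}(g)$, $(n+1)\rho=-\Delta_g(\sigma)-\sigma\mathsf{J}$, $\mathcal{S}(g,\sigma)=|d\sigma|_g^2+2\sigma\rho$. Condition (SY): $\mathcal{S}(g,\sigma)=1+\sigma^{n+1}R_{n+1}$ near $M$ with $R_{n+1}$ smooth up to the boundary. Adapted coordinates: $\mathcal{N}=\operatorname{grad}_g(\sigma)$, $\mathfrak{X}=\mathcal{N}/|\mathcal{N}|^2$ near $M$, $\eta:[0,\varepsilon)\times M\to X$, $\eta(s,x)=\Phi^s_{\mathfrak{X}}(x)$ with $\Phi^s_{\mathfrak{X}}$ the flow of $\mathfrak{X}$. Then $\eta$ is a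 diffeomorphism onto a neighborhood of $M$, $\eta^*(\sigma)=s$ and $\eta^*(g)=\eta^*(|\mathcal{N}|^{-2})ds^2+h_s$ with a one-parameter family $h_s$ of metrics on $M$, $h_0=h$. Put $\mathring{v}(s)=dvol_{h_s}/dvol_h$, so that $\mathring{v}'/\mathring{v}=\frac12\operatorname{tr}(h_s^{-1}h_s')$. In the claim, $\mathsf{J}$ and $\rho$ denote the pull-backs $\eta^*(\mathsf{J})$ and $\eta^*(\rho)$, the prime is $\partial_s$, and $|_0$ is restriction to $s=0$. *)

(* Defs.v *)
From HB Require Import structures.
From mathcomp Require Import all_boot all_order all_algebra.
From mathcomp Require Import all_classical all_reals all_analysis.

Set Implicit Arguments.
Unset Strict Implicit.
Unset Printing Implicit Defensive.

Import Order.TTheory GRing.Theory Num.Theory.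
Import numFieldNormedType.Exports.

Local Open Scope classical_set_scope.
Local Open Scope ring_scope.

(* The filter of difference quotients of f at x in the direction v, along the
   nonzero t with x + t v in A. *)
Definition diff_quot (R : realType) (V : normedModType R) (A : set V)
    (f : V -> R) (v x : V) : set_system R :=
  (fun t : R => t^-1 * (f (x + t *: v) - f x))
    @ within [set t : R | A (x + t *: v)] 0^'.

Definition wderive (R : realType) (V : normedModType R) (A : set V)
    (f : V -> R) (v x : V) : R := lim (diff_quot A f v x).

(* d/ds for functions on [0, +oo[, one-sided at 0. *)
Definition ds (R : realType) (f : R -> R) : R -> R :=
  fun s => wderive (V := R^o) [set u : R^o | 0 <= (u : R)] f 1 s.

Definition half_space (R : realType) (m : nat) : set 'rV[R]_m.+1 :=
  [set z | 0 <= z ord0 ord0].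

Definition pd (R : realType) (m : nat) (i : 'I_m.+1) (f : 'rV[R]_m.+1 -> R)
    (z : 'rV[R]_m.+1) : R :=
  wderive (half_space (m := m)) f (delta_mx ord0 i) z.

Fixpoint Ck (R : realType) (m k : nat) (U : set 'rV[R]_m.+1)
    (f : 'rV[R]_m.+1 -> R) : Prop :=
  (forall z, U z -> {for z, continuous f}) /\
  if k is k'.+1 then
    forall i : 'I_m.+1,
      (forall z, U z -> derivable f z (delta_mx ord0 i)) /\
      Ck k' U (fun z => 'D_(delta_mx ord0 i) f z)
  else True.

(* Smoothness on an arbitrary subset A (in particular, up to the boundary):
   near each point of A, f is the restriction of a smooth function defined on
   an open set. *)
Definition smooth_on (R : realType) (m : nat) (A : set 'rV[R]_m.+1)
    (f : 'rV[R]_m.+1 -> R) : Prop :=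
  forall z, A z -> exists (O : set 'rV[R]_m.+1) (F : 'rV[R]_m.+1 -> R),
    [/\ open O, O z, (forall k, Ck k O F) &
        forall w, A w -> O w -> f w = F w].

(* coord is meaningful on dom only, inv on coord @` dom only. *)
Record chart (R : realType) (m : nat) (Y : Type) := Chart {
  dom : set Y;
  coord : Y -> 'rV[R]_m.+1;
  inv : 'rV[R]_m.+1 -> Y }.

Definition is_chart (R : realType) (m : nat) (X : topologicalType)
    (c : chart R m X) : Prop :=
  [/\ open (dom c),
      (exists2 O : set 'rV[R]_m.+1, open O &
         coord c @` dom c = half_space (m := m) `&` O),
      (forall p, dom c p -> inv c (coord c p) = p),
      {within dom c, continuous (coord c)} &
      {within coord c @` dom c, continuous (inv c)}].

Definition smooth_transition (R : realType) (m : nat) (X : Type)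
    (c c' : chart R m X) : Prop :=
  forall a : 'I_m.+1,
    smooth_on (coord c @` (dom c `&` dom c'))
      (fun z => coord c' (inv c z) ord0 a).

(* A smooth structure with boundary, of dimension m.+1, given by its maximal
   atlas. *)
Record bmanifold (R : realType) (m : nat) (X : topologicalType) := BManifold {
  atlas : set (chart R m X);
  atlas_chart : forall c, atlas c -> is_chart c;
  atlas_cover : forall p, exists2 c, atlas c & dom c p;
  atlas_smooth : forall c c', atlas c -> atlas c' -> smooth_transition c c';
  atlas_max : forall c, is_chart c ->
    (forall c', atlas c' -> smooth_transition c c' /\ smooth_transition c' c) ->
    atlas c }.

Definition boundary (R : realType) (m : nat) (X : topologicalType)
    (mX : bmanifold R m X) : set X :=
  [set p | exists2 c, atlas mX c & dom c p /\ coord c p ord0 ord0 = 0].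

(* Smooth maps on D, between sets endowed with families of charts. *)
Definition smooth_map (R : realType) (m m' : nat) (Y Z : topologicalType)
    (AY : set (chart R m Y)) (AZ : set (chart R m' Z)) (D : set Y)
    (f : Y -> Z) : Prop :=
  {within D, continuous f} /\
  forall c c' (a : 'I_m'.+1), AY c -> AZ c' ->
    smooth_on (coord c @` (dom c `&` D `&` f @^-1` dom c'))
      (fun z => coord c' (f (inv c z)) ord0 a).

Definition diffeo (R : realType) (m m' : nat) (Y Z : topologicalType)
    (AY : set (chart R m Y)) (AZ : set (chart R m' Z)) (D : set Y) (W : set Z)
    (f : Y -> Z) : Prop :=
  f @` D = W /\
  exists finv : Z -> Y,
    [/\ (forall y, D y -> finv (f y) = y),
        smooth_map AY AZ D f & smooth_map AZ AY W finv].

Definition smooth_fun (R : realType) (m : nat) (X : topologicalType)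
    (mX : bmanifold R m X) (W : set X) (f : X -> R) : Prop :=
  forall c, atlas mX c -> smooth_on (coord c @` (dom c `&` W)) (f \o inv c).

(* The partial derivative of f : Y -> R in the i-th coordinate of c. *)
Definition cpd (R : realType) (m : nat) (Y : Type) (c : chart R m Y)
    (i : 'I_m.+1) (f : Y -> R) : Y -> R :=
  fun p => pd i (f \o inv c) (coord c p).

(* A Riemannian metric is given by its components in all the charts of the
   atlas: gcomp g c p is the matrix (g_ij(p)) in the coordinates c. *)
Record metric (R : realType) (m : nat) (X : topologicalType)
    (mX : bmanifold R m X) := Metric {
  gcomp :> chart R m X -> X -> 'M[R]_m.+1;
  gcomp_smooth : forall c i j, atlas mX c ->
    smooth_on (coord c @` dom c) (fun z => gcomp c (inv c z) i j);
  gcomp_sym : forall c p, atlas mX c -> dom c p -> (gcomp c p)^T = gcomp c p;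
  gcomp_pos : forall c p (u : 'rV[R]_m.+1), atlas mX c -> dom c p -> u != 0 ->
    0 < (u *m gcomp c p *m u^T) ord0 ord0;
  gcomp_change : forall c c' p, atlas mX c -> atlas mX c' ->
    dom c p -> dom c' p ->
    let D := \matrix_(i, a) cpd c i (fun q => coord c' q ord0 a) p in
    gcomp c p = D *m gcomp c' p *m D^T }.

Section LocalExpressions.
Variables (R : realType) (m : nat) (X : topologicalType).
Variables (mX : bmanifold R m X) (g : metric mX) (c : chart R m X).
Implicit Types (f : X -> R) (V : 'I_m.+1 -> X -> R).

Definition ginv (i j : 'I_m.+1) : X -> R := fun p => invmx (g c p) i j.

Definition grad f (i : 'I_m.+1) : X -> R :=
  fun p => \sum_j ginv i j p * cpd c j f p.

Definition sqrt_det : X -> R := fun p => Num.sqrt (\det (g c p)).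

Definition div V : X -> R :=
  fun p => (sqrt_det p)^-1 *
           \sum_i cpd c i (fun q => sqrt_det q * V i q) p.

Definition laplace f : X -> R := div (grad f).

(* |df|^2_g, which is also |grad f|^2_g. *)
Definition norm2_d f : X -> R :=
  fun p => \sum_i \sum_j ginv i j p * cpd c i f p * cpd c j f p.

(* christoffel k i j = Gamma^k_(ij) *)
Definition christoffel (k i j : 'I_m.+1) : X -> R :=
  fun p => 2^-1 * \sum_l ginv k l p *
    (cpd c i (fun q => g c q j l) p + cpd c j (fun q => g c q i l) p
     - cpd c l (fun q => g c q i j) p).

Definition ricci (j k : 'I_m.+1) : X -> R :=
  fun p => \sum_i (cpd c i (christoffel i j k) p
                   - cpd c j (christoffel i i k) p
    + \sum_l (christoffel i i l p * christoffel l j k p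
              - christoffel i j l p * christoffel l i k p)).

Definition scal : X -> R :=
  fun p => \sum_j \sum_k ginv j k p * ricci j k p.

End LocalExpressions.

(* u is the function on X whose expression in each chart c is F c. Such a u is
   unique; for the coordinate expressions of invariants of g (scalar curvature,
   Laplacian, |df|^2) it exists because these do not depend on c. *)
Definition in_charts (R : realType) (m : nat) (X : topologicalType)
    (mX : bmanifold R m X) (F : chart R m X -> X -> R) (u : X -> R) : Prop :=
  forall c p, atlas mX c -> dom c p -> u p = F c p.

Definition is_scal (R : realType) (m : nat) (X : topologicalType)
    (mX : bmanifold R m X) (g : metric mX) (u : X -> R) : Prop :=
  in_charts mX (fun c => scal g c) u.

Definition is_laplacian (R : realType) (m : nat) (X : topologicalType)
    (mX : bmanifold R m X) (g : metric mX) (f u : X -> R) : Prop :=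
  in_charts mX (fun c => laplace g c f) u.

Definition is_norm2_d (R : realType) (m : nat) (X : topologicalType)
    (mX : bmanifold R m X) (g : metric mX) (f u : X -> R) : Prop :=
  in_charts mX (fun c => norm2_d g c f) u.

Definition boundary_defining (R : realType) (m : nat) (X : topologicalType)
    (mX : bmanifold R m X) (sigma : X -> R) : Prop :=
  [/\ smooth_fun mX setT sigma,
      (forall p, sigma p = 0 <-> boundary mX p),
      (forall p, ~ boundary mX p -> 0 < sigma p) &
      forall c p, atlas mX c -> dom c p -> boundary mX p ->
        exists i, cpd c i sigma p != 0].

(* 2 n J = scal(g), where dim X = n.+1. *)
Definition is_schouten_trace (R : realType) (n : nat) (X : topologicalType)
    (mX : bmanifold R n X) (g : metric mX) (J : X -> R) : Prop :=
  is_scal g (fun p => 2 * n%:R * J p).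

Definition is_rho (R : realType) (n : nat) (X : topologicalType)
    (mX : bmanifold R n X) (g : metric mX) (sigma J rho : X -> R) : Prop :=
  exists2 L, is_laplacian g sigma L &
    forall p, n.+1%:R * rho p = - L p - sigma p * J p.

Definition condition_SY (R : realType) (n : nat) (X : topologicalType)
    (mX : bmanifold R n X) (g : metric mX) (sigma rho : X -> R) : Prop :=
  exists2 N2, is_norm2_d g sigma N2 &
  exists (W : set X) (Rn : X -> R),
    [/\ open W, boundary mX `<=` W, smooth_fun mX W Rn &
        forall p, W p ->
          N2 p + 2 * sigma p * rho p = 1 + sigma p ^+ n.+1 * Rn p].

Definition collar (R : realType) (m : nat) (X : topologicalType)
    (mX : bmanifold R m X) (eps : R) : set (R * X) :=
  [set q | 0 <= q.1 < eps /\ boundary mX q.2].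

Definition set_coord0 (R : realType) (m : nat) (s : R) (z : 'rV[R]_m.+1) :
    'rV[R]_m.+1 :=
  \row_j if j == ord0 then s else z ord0 j.

(* The chart of [0, eps[ x M induced by a chart c of X: the coordinate 0 of c,
   which vanishes on M, is replaced by s. *)
Definition collar_chart (R : realType) (m : nat) (X : topologicalType)
    (mX : bmanifold R m X) (eps : R) (c : chart R m X) : chart R m (R * X) :=
  Chart (collar mX eps `&` [set q | dom c q.2])
        (fun q => set_coord0 q.1 (coord c q.2))
        (fun z => (z ord0 ord0, inv c (set_coord0 0 z))).

Definition collar_atlas (R : realType) (m : nat) (X : topologicalType)
    (mX : bmanifold R m X) (eps : R) : set (chart R m (R * X)) :=
  collar_chart mX eps @` atlas mX.

(* The i-th component in c of the vector field grad sigma / |grad sigma|^2. *)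
Definition normalized_grad (R : realType) (m : nat) (X : topologicalType)
    (mX : bmanifold R m X) (g : metric mX) (sigma : X -> R) (c : chart R m X)
    (i : 'I_m.+1) : X -> R :=
  fun p => grad g c sigma i p / norm2_d g c sigma p.

(* eta s x, for 0 <= s < eps and x in M, is the flow of the vector field
   grad sigma / |grad sigma|^2, and eps is so small that eta is a
   diffeomorphism of [0, eps[ x M onto a neighborhood of M. *)
Definition adapted_coordinates (R : realType) (m : nat) (X : topologicalType)
    (mX : bmanifold R m X) (g : metric mX) (sigma : X -> R) (eps : R)
    (eta : R -> X -> X) : Prop :=
  [/\ 0 < eps,
      (forall x, boundary mX x -> eta 0 x = x),
      (forall s x c (i : 'I_m.+1), 0 <= s < eps -> boundary mX x ->
         atlas mX c -> dom c (eta s x) ->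
         diff_quot (V := R^o) [set u : R^o | 0 <= (u : R)]
           (fun u => coord c (eta u x) ord0 i) 1 s
         --> normalized_grad g sigma c i (eta s x)) &
      exists W : set X,
        [/\ open W, boundary mX `<=` W &
            diffeo (collar_atlas mX eps) (atlas mX) (collar mX eps) W
              (fun q => eta q.1 q.2)]].

(* Components of tensors on M are taken in the coordinates (c_1, ..., c_m)
   induced by a chart c of X. h is the pull-back f^* g to M of g under f : M -> X; the
   inclusion of M corresponds to f = id. *)
Definition is_pullback (R : realType) (m : nat) (X : topologicalType)
    (mX : bmanifold R m X) (g : metric mX) (f : X -> X)
    (h : chart R m X -> X -> 'M[R]_m) : Prop :=
  forall c c' x, atlas mX c -> atlas mX c' -> boundary mX x ->
    dom c x -> dom c' (f x) ->
    let D := \matrix_(i < m, a < m.+1)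
               cpd c (lift ord0 i) (fun q => coord c' (f q) ord0 a) x in
    h c x = D *m g c' (f x) *m D^T.

(* v = dvol_h' / dvol_h on M *)
Definition is_volume_ratio (R : realType) (m : nat) (X : topologicalType)
    (mX : bmanifold R m X) (h' h : chart R m X -> X -> 'M[R]_m)
    (v : X -> R) : Prop :=
  forall c x, atlas mX c -> boundary mX x -> dom c x ->
    v x = Num.sqrt (\det (h' c x)) / Num.sqrt (\det (h c x)).

(* Main.v *)
From Pilot Require Import Defs.
From HB Require Import structures.
From mathcomp Require Import all_boot all_order all_algebra.
From mathcomp Require Import all_classical all_reals all_analysis.
From mathcomp Require Import ring.

(** The adapted coordinates turn the claim into a statement about functions of
    one variable, and everything is computed along the single curve
    s |-> eta(s, x).  Put a = |d sigma|^2, beta = the density of the slice metric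
    h_s in the tangential coordinates, and w = v'/v = beta'/beta along it.

    In adapted coordinates sigma is the coordinate s and the metric is
    a^-1 ds^2 + h_s.  Its volume density is beta / sqrt a and
    grad sigma = a d/ds, hence
      Laplacian(sigma) = (sqrt a / beta) (sqrt a beta)' = a w + a'/2
    ([laplace_adapted], [laplace_curve]).  The definition of rho says that this
    is -(n+1) rho - s J, and condition (SY) says a = 1 - 2 s rho + s^(n+1) T
    with T smooth ([SY_curve]).  Eliminating a leaves
      n rho = s (rho' + 2 rho w - J) - w - (s^(n+1) T w + (s^(n+1) T)'/2)
    ([first_order_identity]).  Apply the k-th derivative at s = 0.  The
    derivatives of order at most n of a multiple of s^(n+1) vanish there, and
    this is where k <= n - 1 enters; a factor s contributes
    (s f)^(k) (0) = k f^(k-1) (0); and the Leibniz rule for rho w with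
    k C(k-1, j-1) = j C(k, j) gives the sum of the claim
    ([iterated_identity]).

    Two points make these computations legitimate.

    Adapted coordinates are coordinates of X.  The map that reads eta(s, x) as s
    followed by the tangential coordinates of x in a chart c0 satisfies the
    axioms of a chart, and its transitions with the atlas are smooth because eta
    is a diffeomorphism; so it lies in the maximal atlas
    ([exists_adapted_chart]), and every invariant of g may be computed in it.
    This replaces all changes of variables.  For instance the flow equation of
    eta, read in this chart, says directly that grad sigma / |grad sigma|^2 is
    the first coordinate field ([normalized_gradE]); with
    d sigma (grad sigma) = |grad sigma|^2 this yields d sigma / ds = 1, hence
    sigma = s ([sigma_coord0]), and then the block form of the inverse metric
    ([ginv_adapted]).

    All functions involved are smooth in s up to s = 0.  Derivatives are iterated
    directional limits inside the half-space, so smoothness is used in the form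
    of existence of all these iterated limits ([smooth_along]).  That class is
    closed under ring operations, inverses, square roots and partial derivatives
    and passes to the lines in the direction s ([smooth1_line]); thus the scalar
    curvature, hence J, and the Laplacian of sigma, hence rho, are smooth along
    the curve. *)

Set Implicit Arguments.
Unset Strict Implicit.
Unset Printing Implicit Defensive.

Import Order.TTheory GRing.Theory Num.Theory.
Import numFieldNormedType.Exports.

(* coord, dom and inv denote the projections of charts from here on *)
Import Pilot.Defs.

Local Open Scope classical_set_scope.
Local Open Scope ring_scope.

(** * Calculus of directional derivatives relative to a set *)

Lemma cvg_near_eq (R : realType) (F : set_system R) {FF : Filter F}
    (f g : R -> R) (l : R) :
  f @ F --> l -> (\forall t \near F, f t = g t) -> g @ F --> l.
Proof.
move=> fl fg; apply: cvg_trans fl; apply: near_eq_cvg.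
by apply: filterS fg => t ->.
Qed.

Section DiffQuot.
Variables (R : realType) (V : normedModType R) (A : set V).
Implicit Types (f g : V -> R) (v x : V) (l m : R).

Definition dir_nbhs v x : set_system R :=
  within [set t : R | A (x + t *: v)] 0^'.

Global Instance dir_nbhs_filter v x : Filter (dir_nbhs v x).
Proof. exact: within_filter. Qed.

Lemma dir_nbhs_neq0 v x : \forall t \near dir_nbhs v x, t != 0.
Proof. exact: (cvg_within _ (nbhs_dnbhs_neq (0 : R))). Qed.

Lemma dir_nbhs_cvg0 v x : id @ dir_nbhs v x --> (0 : R).
Proof. by move=> P P0; exact: (cvg_within _ (nbhs_dnbhs P0)). Qed.

Lemma diff_quotP f v x l : diff_quot A f v x --> l ->
  t^-1 * (f (x + t *: v) - f x) @[t --> dir_nbhs v x] --> l.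
Proof. by []. Qed.

Lemma diff_quot_intro f v x l (u : R -> R) : u @ dir_nbhs v x --> l ->
  (\forall t \near dir_nbhs v x, u t = t^-1 * (f (x + t *: v) - f x)) ->
  diff_quot A f v x --> l.
Proof. exact: cvg_near_eq. Qed.

Lemma diff_quot_near f g v x l :
  f x = g x -> (\forall t \near dir_nbhs v x, f (x + t *: v) = g (x + t *: v)) ->
  diff_quot A f v x --> l -> diff_quot A g v x --> l.
Proof.
move=> fgx fg fl; apply: (diff_quot_intro (diff_quotP fl)).
by near=> t; rewrite -fgx; congr (_ * (_ - _)); near: t.
Unshelve. all: by end_near. Qed.

(** The product, inverse and square root rules need continuity along the direction
    of derivation, and the convergence of the difference quotient provides it. *)
Lemma diff_quot_continuous f v x l : diff_quot A f v x --> l ->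
  f (x + t *: v) @[t --> dir_nbhs v x] --> f x.
Proof.
move=> fl.
have h : f x + t * (t^-1 * (f (x + t *: v) - f x)) @[t --> dir_nbhs v x]
    --> f x + 0 * l.
  by apply: cvgD; [exact: cvg_cst|apply: cvgM => //; exact: dir_nbhs_cvg0].
rewrite mul0r addr0 in h; apply: (cvg_near_eq h).
near=> t; rewrite mulrA mulfV ?mul1r ?(addrC (f x)) ?subrK //.
by near: t; exact: dir_nbhs_neq0.
Unshelve. all: by end_near. Qed.

Lemma diff_quot_cst c v x : diff_quot A (fun=> c) v x --> (0 : R).
Proof.
rewrite /diff_quot; under eq_fun do rewrite subrr mulr0.
exact: cvg_cst.
Qed.

Lemma diff_quotD f g v x l m : diff_quot A f v x --> l ->
  diff_quot A g v x --> m -> diff_quot A (fun y => f y + g y) v x --> l + m.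
Proof.
move=> fl gm; pose proof (cvgD (diff_quotP fl) (diff_quotP gm)) as h.
apply: (diff_quot_intro h).
by near=> t; rewrite /= -mulrDr addrACA opprD.
Unshelve. all: by end_near. Qed.

Lemma diff_quotM f g v x l m : diff_quot A f v x --> l ->
  diff_quot A g v x --> m ->
  diff_quot A (fun y => f y * g y) v x --> l * g x + f x * m.
Proof.
move=> fl gm.
pose proof (cvgD (cvgM (diff_quotP fl) (diff_quot_continuous gm))
  (cvgM (cvg_cst (f x)) (diff_quotP gm))) as h.
apply: (diff_quot_intro h); near=> t; rewrite ?fctE /=.
by ring.
Unshelve. all: by end_near. Qed.

Lemma diff_quotV f v x l : f x != 0 -> diff_quot A f v x --> l ->
  diff_quot A (fun y => (f y)^-1) v x --> - l * ((f x)^-1 * (f x)^-1).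
Proof.
move=> fx0 fl.
have fc := diff_quot_continuous fl.
pose proof (cvgM (cvgN (diff_quotP fl)) (cvgM (cvg_cst (f x)^-1) (cvgV fx0 fc))) as h.
apply: (diff_quot_intro h); near=> t; rewrite ?fctE /=.
have ft0 : f (x + t *: v) != 0.
  by near: t; apply: (cvgr_neq0 (f x)) => //.
have t0 : t != 0 by near: t; exact: dir_nbhs_neq0.
by field; rewrite fx0 ft0.
Unshelve. all: by end_near. Qed.

Lemma diff_quot_sqrt f v x l : 0 < f x -> diff_quot A f v x --> l ->
  diff_quot A (fun y => Num.sqrt (f y)) v x -->
    l * (2 * Num.sqrt (f x))^-1.
Proof.
move=> fx0 fl.
have fc := diff_quot_continuous fl.
have sc : Num.sqrt (f (x + t *: v)) @[t --> dir_nbhs v x] --> Num.sqrt (f x).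
  by apply: continuous_cvg fc; exact: sqrt_continuous.
have sx0 : 0 < Num.sqrt (f x) by rewrite sqrtr_gt0.
have d0 : Num.sqrt (f x) + Num.sqrt (f x) != 0 by rewrite gt_eqF ?addr_gt0.
pose proof (cvgM (diff_quotP fl) (cvgV d0 (cvgD sc (cvg_cst (Num.sqrt (f x)))))) as h.
rewrite (_ : 2 * Num.sqrt (f x) = Num.sqrt (f x) + Num.sqrt (f x)); last by ring.
apply: (diff_quot_intro h); near=> t; rewrite ?fctE /=.
have ft0 : 0 < f (x + t *: v) by near: t; apply: (cvgr_gt (f x)).
have st0 : 0 < Num.sqrt (f (x + t *: v)) by rewrite sqrtr_gt0.
rewrite -mulrA; congr (_ * _).
rewrite -{1}(sqr_sqrtr (ltW ft0)) -{1}(sqr_sqrtr (ltW fx0)).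
by field; rewrite gt_eqF // addr_gt0.
Unshelve. all: by end_near. Qed.

End DiffQuot.

Section Smooth.
Variables (R : realType) (V : normedModType R) (A : set V).
Variables (I : Type) (E : I -> V).
Implicit Types (U : set V) (f g : V -> R) (i : I) (l : R).

(** The hypotheses under which directional derivatives at points of [U] are
    unique, and depend only on the values on [U]. *)
Definition dir_open U := forall x i, U x ->
  ProperFilter (dir_nbhs A (E i) x) /\
  \forall t \near dir_nbhs A (E i) x, U (x + t *: E i).

Definition differentiable_along U f := forall x i, U x ->
  diff_quot A f (E i) x --> wderive A f (E i) x.

(** Functions are only ever compared along lines, where [diff_quot_continuous]
    supplies continuity, so the existence of the iterated limits is the whole
    condition. *)
Fixpoint smooth_upto (k : nat) U f : Prop :=
  if k is k'.+1 then
    differentiable_along U f /\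
    forall i, smooth_upto k' U (wderive A f (E i))
  else True.

Definition smooth_along U f := forall k, smooth_upto k U f.

Lemma smooth_upto_sub k U U' f : U' `<=` U ->
  smooth_upto k U f -> smooth_upto k U' f.
Proof.
move=> UU'; elim: k f => [|k IH] f //= [fd fk]; split=> [x i /UU'|i].
  exact: fd.
exact: IH.
Qed.

(** Smoothness is given by local extensions, so it has to be glued. *)
Lemma smooth_upto_local k U f :
  (forall x, U x -> exists2 W, W x & smooth_upto k (U `&` W) f) ->
  smooth_upto k U f.
Proof.
elim: k f => [|k IH] f //= loc; split=> [x i Ux|i].
  by have [W Wx [fd _]] := loc _ Ux; exact: fd.
by apply: IH => x /loc[W Wx [_ fk]]; exists W.
Qed.

Section DirOpen.
Variable U : set V.
Hypothesis oU : dir_open U.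

Lemma wderive_eq f i x l : U x -> diff_quot A f (E i) x --> l ->
  wderive A f (E i) x = l.
Proof. by move=> /oU-/(_ i)[pF _] /cvg_lim; apply. Qed.

Lemma near_dir_eq f g i x : {in U, f =1 g} -> U x ->
  \forall t \near dir_nbhs A (E i) x, f (x + t *: E i) = g (x + t *: E i).
Proof.
move=> fg Ux; have [pF nU] := oU i Ux.
by near=> t; apply: fg; rewrite inE; near: t.
Unshelve. all: by end_near. Qed.

Lemma diff_quot_ext f g i x l : {in U, f =1 g} -> U x ->
  diff_quot A f (E i) x --> l -> diff_quot A g (E i) x --> l.
Proof.
move=> fg Ux; apply: diff_quot_near; last exact: near_dir_eq.
by apply: fg; rewrite inE.
Qed.

Lemma wderive_ext f g i : {in U, f =1 g} -> differentiable_along U f ->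
  {in U, wderive A f (E i) =1 wderive A g (E i)}.
Proof.
move=> fg fd x; rewrite inE => Ux; apply/esym/wderive_eq => //.
by apply: (diff_quot_ext fg) => //; exact: fd.
Qed.

Lemma smooth_upto_ext k f g : {in U, f =1 g} ->
  smooth_upto k U f -> smooth_upto k U g.
Proof.
elim: k f g => [|k IH] f g fg //= [fd fk]; split=> [x i Ux|i].
  have h := diff_quot_ext fg Ux (fd _ i Ux).
  by rewrite (wderive_eq Ux h).
by apply: IH (fk i); exact: wderive_ext.
Qed.

Lemma smooth_uptoS k f : smooth_upto k.+1 U f -> smooth_upto k U f.
Proof.
elim: k f => [|k IH] f // [fd fk]; split=> // i; exact/IH/fk.
Qed.

(** All closure properties below are proved by induction on the order with this
    lemma: exhibit the derivative and show that it is smooth to one order less. *)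
Lemma smooth_upto_der k f (F : I -> V -> R) :
  (forall x i, U x -> diff_quot A f (E i) x --> F i x) ->
  (forall i, smooth_upto k U (F i)) -> smooth_upto k.+1 U f.
Proof.
move=> fF Fk; split=> [x i Ux|i].
  by rewrite (wderive_eq Ux (fF _ _ Ux)); exact: fF.
apply: smooth_upto_ext (Fk i) => x; rewrite inE => Ux.
by rewrite (wderive_eq Ux (fF _ _ Ux)).
Qed.

Lemma smooth_upto_cst k c : smooth_upto k U (fun=> c).
Proof.
elim: k c => // k IH c; apply: (smooth_upto_der (F := fun _ _ => 0)) => // x i _.
exact: diff_quot_cst.
Qed.

Lemma smooth_uptoD k f g : smooth_upto k U f -> smooth_upto k U g ->
  smooth_upto k U (fun x => f x + g x).
Proof.
elim: k f g => // k IH f g [fd fk] [gd gk].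
apply: (smooth_upto_der
  (F := fun i x => wderive A f (E i) x + wderive A g (E i) x)) => [x i Ux|i].
  by apply: diff_quotD; [exact: fd|exact: gd].
exact: (IH _ _ (fk i) (gk i)).
Qed.

Lemma smooth_uptoM k f g : smooth_upto k U f -> smooth_upto k U g ->
  smooth_upto k U (fun x => f x * g x).
Proof.
elim: k f g => // k IH f g fS gS; have [fd fk] := fS; have [gd gk] := gS.
apply: (smooth_upto_der (F := fun i x =>
  wderive A f (E i) x * g x + f x * wderive A g (E i) x)) => [x i Ux|i].
  by apply: diff_quotM; [exact: fd|exact: gd].
apply: smooth_uptoD.
  exact: (IH _ _ (fk i) (smooth_uptoS gS)).
exact: (IH _ _ (smooth_uptoS fS) (gk i)).
Qed.

Lemma smooth_uptoV k f : (forall x, U x -> f x != 0) -> smooth_upto k U f ->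
  smooth_upto k U (fun x => (f x)^-1).
Proof.
move=> f0; elim: k => // k IH fS; have [fd fk] := fS.
have iS := IH (smooth_uptoS fS).
apply: (smooth_upto_der (F := fun i x =>
  (-1) * wderive A f (E i) x * ((f x)^-1 * (f x)^-1))) => [x i Ux|i].
  by rewrite mulN1r; apply: diff_quotV; [exact: f0|exact: fd].
apply: smooth_uptoM; last exact: smooth_uptoM.
apply: smooth_uptoM; first exact: smooth_upto_cst.
exact: fk.
Qed.

Lemma smooth_upto_sqrt k f : (forall x, U x -> 0 < f x) -> smooth_upto k U f ->
  smooth_upto k U (fun x => Num.sqrt (f x)).
Proof.
move=> f0; elim: k => // k IH fS; have [fd fk] := fS.
have iS := IH (smooth_uptoS fS).
apply: (smooth_upto_der (F := fun i x =>
  wderive A f (E i) x * (2 * Num.sqrt (f x))^-1)) => [x i Ux|i].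
  by apply: diff_quot_sqrt; [exact: f0|exact: fd].
apply: smooth_uptoM; [exact: fk|apply: smooth_uptoV].
  by move=> x Ux; rewrite mulf_neq0 ?pnatr_eq0 // gt_eqF // sqrtr_gt0 f0.
by apply: smooth_uptoM => //; exact: smooth_upto_cst.
Qed.

Lemma smooth_along_diff f : smooth_along U f -> differentiable_along U f.
Proof. by move=> /(_ 1%N)[]. Qed.

Lemma smooth_along_wderive f i : smooth_along U f ->
  smooth_along U (wderive A f (E i)).
Proof. by move=> fS k; have [_ fk] := fS k.+1; exact: fk. Qed.

Lemma smooth_along_ext f g : {in U, f =1 g} -> smooth_along U f ->
  smooth_along U g.
Proof. by move=> fg fS k; exact: (smooth_upto_ext fg (fS k)). Qed.

Lemma smooth_along_cst c : smooth_along U (fun=> c).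
Proof. by move=> k; exact: smooth_upto_cst. Qed.

Lemma smooth_alongD f g : smooth_along U f -> smooth_along U g ->
  smooth_along U (fun x => f x + g x).
Proof. by move=> fS gS k; exact: smooth_uptoD. Qed.

Lemma smooth_alongM f g : smooth_along U f -> smooth_along U g ->
  smooth_along U (fun x => f x * g x).
Proof. by move=> fS gS k; exact: smooth_uptoM. Qed.

Lemma smooth_alongN f : smooth_along U f -> smooth_along U (fun x => - f x).
Proof.
move=> fS; have := smooth_alongM (smooth_along_cst (-1)) fS.
by apply: smooth_along_ext => x _; rewrite mulN1r.
Qed.

Lemma smooth_alongB f g : smooth_along U f -> smooth_along U g ->
  smooth_along U (fun x => f x - g x).
Proof. by move=> fS gS; exact/smooth_alongD/smooth_alongN. Qed.

Lemma smooth_alongV f : (forall x, U x -> f x != 0) -> smooth_along U f ->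
  smooth_along U (fun x => (f x)^-1).
Proof. by move=> f0 fS k; exact: smooth_uptoV. Qed.

Lemma smooth_along_sqrt f : (forall x, U x -> 0 < f x) -> smooth_along U f ->
  smooth_along U (fun x => Num.sqrt (f x)).
Proof. by move=> f0 fS k; exact: smooth_upto_sqrt. Qed.

Lemma smooth_alongX f m : smooth_along U f -> smooth_along U (fun x => f x ^+ m).
Proof.
move=> fS; elim: m => [|m IH]; first exact: smooth_along_cst.
by under eq_fun do rewrite exprS; exact: smooth_alongM.
Qed.

Lemma smooth_along_sum (J : Type) (r : seq J) (P : pred J) (F : J -> V -> R) :
  (forall j, smooth_along U (F j)) ->
  smooth_along U (fun x => \sum_(j <- r | P j) F j x).
Proof.
move=> FS; elim: r => [|j r IH].
  by under eq_fun do rewrite big_nil; exact: smooth_along_cst.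
by under eq_fun do rewrite big_cons; case: (P j) => //; exact: smooth_alongD.
Qed.

Lemma smooth_along_prod (J : Type) (r : seq J) (P : pred J) (F : J -> V -> R) :
  (forall j, smooth_along U (F j)) ->
  smooth_along U (fun x => \prod_(j <- r | P j) F j x).
Proof.
move=> FS; elim: r => [|j r IH].
  by under eq_fun do rewrite big_nil; exact: smooth_along_cst.
by under eq_fun do rewrite big_cons; case: (P j) => //; exact: smooth_alongM.
Qed.

Lemma smooth_along_det m (M : V -> 'M[R]_m) :
  (forall a b, smooth_along U (fun x => M x a b)) ->
  smooth_along U (fun x => \det (M x)).
Proof.
move=> MS; apply: smooth_along_sum => s; apply: smooth_alongM.
  exact: smooth_along_cst.
exact: smooth_along_prod.
Qed.

(** Cramer's rule. *)
Lemma smooth_along_invmx m (M : V -> 'M[R]_m) a b :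
  (forall x, U x -> \det (M x) != 0) ->
  (forall a b, smooth_along U (fun x => M x a b)) ->
  smooth_along U (fun x => invmx (M x) a b).
Proof.
move=> M0 MS.
have h : smooth_along U (fun x => (\det (M x))^-1 *
    ((-1) ^+ (b + a) * \det (row' b (col' a (M x))))).
  apply: smooth_alongM.
    by apply: smooth_alongV => //; exact: smooth_along_det.
  apply: smooth_alongM; first exact: smooth_along_cst.
  apply: smooth_along_det => c d.
  by under eq_fun do rewrite !mxE; exact: MS.
apply: smooth_along_ext h => x; rewrite inE => Ux.
by rewrite /invmx unitmxE unitfE M0 // !mxE.
Qed.

Lemma wderiveD f g i x : smooth_along U f -> smooth_along U g -> U x ->
  wderive A (fun y => f y + g y) (E i) x =
  wderive A f (E i) x + wderive A g (E i) x.
Proof.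
move=> fS gS Ux; apply: wderive_eq => //.
by apply: diff_quotD; exact: smooth_along_diff.
Qed.

Lemma wderiveM f g i x : smooth_along U f -> smooth_along U g -> U x ->
  wderive A (fun y => f y * g y) (E i) x =
  wderive A f (E i) x * g x + f x * wderive A g (E i) x.
Proof.
move=> fS gS Ux; apply: wderive_eq => //.
by apply: diff_quotM; exact: smooth_along_diff.
Qed.

Lemma wderive_cst c i x : U x -> wderive A (fun=> c) (E i) x = 0.
Proof. by move=> Ux; apply: wderive_eq => //; exact: diff_quot_cst. Qed.

End DirOpen.
End Smooth.

(** * Relatively open sets, and functions on a half-open interval *)

Section RelativelyOpen.
Variables (R : realType) (V : normedModType R) (A : set V).
Variables (I : Type) (E : I -> V).
Hypothesis AE : forall x i (t : R), A x -> 0 < t -> A (x + t *: E i).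

Lemma near_dir_nbhs (O : set V) x v : open O -> O x ->
  \forall t \near dir_nbhs A v x, O (x + t *: v).
Proof.
move=> oO Ox.
have cv : continuous (fun t : R => x + t *: v).
  move=> t; apply: cvgD; first exact: cvg_cst.
  by apply: cvgZr_tmp; exact: cvg_id.
have h : \forall t \near (0 : R), O (x + t *: v).
  by apply: cv; rewrite scale0r addr0; exact: open_nbhs_nbhs.
exact: (cvg_within [set t | A (x + t *: v)] (nbhs_dnbhs h)).
Qed.

(** Points of [A] may lie on its boundary, so uniqueness of the limits comes from
    the increments [t > 0] alone. *)
Lemma dir_open_relative (O : set V) : open O -> dir_open A E (A `&` O).
Proof.
move=> oO x i [Ax Ox]; split.
  apply: Build_ProperFilter_ex => P P0.
  have P1 : \forall t \near (0 : R), t != 0 -> A (x + t *: E i) -> P t by exact: P0.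
  have P2 : (0 : R)^'+ P.
    by apply: filterS P1 => t Pt t0; apply: Pt; [rewrite gt_eqF|exact: AE].
  by have [t Pt] := filter_ex P2; exists t.
have AT : dir_nbhs A (E i) x [set t | A (x + t *: E i)] by exact: withinT.
exact: (filterI AT (near_dir_nbhs (E i) oO Ox)).
Qed.

End RelativelyOpen.

Section OneVariable.
Variable R : realType.
Implicit Types (d s : R) (f g : R -> R).

Definition halfline : set R^o := [set u : R^o | 0 <= (u : R)].
Definition halfopen d : set R^o := halfline `&` [set u : R^o | (u : R) < d].
Definition unitdir (_ : unit) : R^o := 1.

Definition smooth1 d f := smooth_along (V := R^o) halfline unitdir (halfopen d) f.

Lemma halfopen_dir_open d : dir_open halfline unitdir (halfopen d).
Proof.
apply: dir_open_relative; last exact: open_lt.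
move=> x i t; rewrite /halfline /= => x0 t0.
by rewrite addr_ge0 // /unitdir [t *: _]mulr1 ltW.
Qed.

Arguments halfopen_dir_open : clear implicits.

Lemma smooth1_le d d' f : d' <= d -> smooth1 d f -> smooth1 d' f.
Proof.
move=> dd fS k; apply: smooth_upto_sub (fS k) => s [s0 sd]; split=> //.
exact: lt_le_trans dd.
Qed.

Lemma smooth1_cst d c : smooth1 d (fun=> c).
Proof. exact: (smooth_along_cst (halfopen_dir_open d)). Qed.

Lemma smooth1D d f g : smooth1 d f -> smooth1 d g -> smooth1 d (fun s => f s + g s).
Proof. exact: (smooth_alongD (halfopen_dir_open d)). Qed.

Lemma smooth1M d f g : smooth1 d f -> smooth1 d g -> smooth1 d (fun s => f s * g s).
Proof. exact: (smooth_alongM (halfopen_dir_open d)). Qed.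

Lemma smooth1_ds d f : smooth1 d f -> smooth1 d (ds f).
Proof. exact: (smooth_along_wderive tt). Qed.

Lemma smooth1_iter d f k : smooth1 d f -> smooth1 d (iter k (@ds R) f).
Proof. by move=> fS; elim: k => //= k IH; exact: smooth1_ds. Qed.

Lemma diff_quot_id s i : diff_quot halfline id (unitdir i) s --> (1 : R).
Proof.
apply: (diff_quot_intro (u := fun=> 1)); first exact: cvg_cst.
have := dir_nbhs_neq0 halfline (unitdir i) s; apply: filterS => t t0.
by rewrite addrAC subrr add0r /unitdir [t *: _]mulr1 mulVf.
Qed.

Lemma smooth1_id d : smooth1 d id.
Proof.
move=> [|k] //.
apply: (smooth_upto_der (halfopen_dir_open d) (F := fun _ _ => 1)) => [x i _|i].
  exact: diff_quot_id.
exact: (smooth_upto_cst (halfopen_dir_open d)).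
Qed.

Lemma ds_id d s : halfopen d s -> ds id s = 1.
Proof.
move=> Us; apply: (wderive_eq (halfopen_dir_open d) (i := tt) Us).
exact: diff_quot_id.
Qed.

Lemma ds_ext d f g : {in halfopen d, f =1 g} -> smooth1 d f ->
  {in halfopen d, ds f =1 ds g}.
Proof.
move=> fg fS; apply: (wderive_ext (halfopen_dir_open d) tt fg).
exact: smooth_along_diff.
Qed.

Lemma iter_ds_ext d f g k : {in halfopen d, f =1 g} -> smooth1 d f ->
  {in halfopen d, iter k (@ds R) f =1 iter k (@ds R) g}.
Proof.
move=> fg fS; elim: k => //= k IH; apply: ds_ext => //; exact: smooth1_iter.
Qed.

Lemma dsD d f g s : smooth1 d f -> smooth1 d g -> halfopen d s ->
  ds (fun u => f u + g u) s = ds f s + ds g s.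
Proof. by move=> fS gS; exact: (wderiveD (halfopen_dir_open d) tt fS gS). Qed.

Lemma dsM d f g s : smooth1 d f -> smooth1 d g -> halfopen d s ->
  ds (fun u => f u * g u) s = ds f s * g s + f s * ds g s.
Proof. by move=> fS gS; exact: (wderiveM (halfopen_dir_open d) tt fS gS). Qed.

Lemma ds_cst d c s : halfopen d s -> ds (fun=> c) s = 0.
Proof. by move=> Us; exact: (wderive_cst (halfopen_dir_open d) c tt Us). Qed.

Lemma iter_dsD d f g k s : smooth1 d f -> smooth1 d g -> halfopen d s ->
  iter k (@ds R) (fun u => f u + g u) s = iter k (@ds R) f s + iter k (@ds R) g s.
Proof.
move=> fS gS; elim: k f g fS gS => // k IH f g fS gS Us; rewrite !iterSr.
rewrite (@iter_ds_ext d _ (fun u => ds f u + ds g u)) ?inE //.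
- by apply: IH => //; exact: smooth1_ds.
- by move=> u; rewrite inE; exact: dsD.
- by apply: smooth1_ds; exact: smooth1D.
Qed.

Lemma iter_dsM d f g k s : smooth1 d f -> smooth1 d g -> halfopen d s ->
  iter k (@ds R) (fun u => f u * g u) s =
  \sum_(i < k.+1) 'C(k, i)%:R * iter i (@ds R) f s * iter (k - i) (@ds R) g s.
Proof.
move=> fS gS; elim: k f g fS gS => [|k IH] f g fS gS Us.
  by rewrite big_ord_recl big_ord0 bin0 mul1r addr0.
have fS' := smooth1_ds fS; have gS' := smooth1_ds gS.
rewrite iterSr.
rewrite (@iter_ds_ext d _ (fun u => ds f u * g u + f u * ds g u)) ?inE //;
  first last.
- by apply: smooth1_ds; exact: smooth1M.
- by move=> u; rewrite inE; exact: dsM.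
rewrite (@iter_dsD d) //; [|exact: smooth1M..].
rewrite !IH // [RHS]big_ord_recl bin0 mul1r subn0 /=.
under [X in X + _ = _]eq_bigr do rewrite -iterSr.
under [X in _ + X = _]eq_bigr => i _ do
  rewrite -iterSr -subSn -1?ltnS //.
under [X in _ = _ + X]eq_bigr => i _ do
  rewrite /bump /= add1n binS natrD mulrDl mulrDl subSS.
rewrite big_split /= addrA [LHS]addrC; congr (_ + _).
rewrite [LHS]big_ord_recl [X in _ = _ + X]big_ord_recr /=
  bin0 (bin_small (ltnSn k)).
rewrite !mul0r addr0 mul1r; congr (_ + _).
Qed.

Lemma iter_ds_idM d f k s : smooth1 d f -> halfopen d s ->
  iter k (@ds R) (fun u => u * f u) s =
  s * iter k (@ds R) f s + k%:R * iter k.-1 (@ds R) f s.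
Proof.
elim: k f => [|k IH] f fS Us; first by rewrite mul0r addr0.
rewrite iterSr (@iter_ds_ext d _ (fun u => f u + u * ds f u)) ?inE //.
- rewrite (@iter_dsD d) //; last first.
    apply: smooth1M; first exact: smooth1_id.
    exact: smooth1_ds.
  rewrite IH //; last exact: smooth1_ds.
  rewrite -iterSr; case: k {IH} => [|k] /=; first by rewrite mul0r mul1r; ring.
  by rewrite -iterS -iterSr /= -[k.+2%:R]natr1; ring.
- move=> u; rewrite inE => Uu.
  by rewrite (@dsM d id f u) ?(@ds_id d) // ?mul1r //; exact: smooth1_id.
- apply: smooth1_ds; apply: smooth1M => //.
  exact: smooth1_id.
Qed.

Lemma halfopen0 d : 0 < d -> halfopen d 0.
Proof. by move=> d0; split=> //; exact: lexx. Qed.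

Lemma smooth1X d m : smooth1 d (fun s => s ^+ m).
Proof. by apply: (smooth_alongX (halfopen_dir_open d)); exact: smooth1_id. Qed.

Lemma iter_ds_id0 d f k : 0 < d -> smooth1 d f ->
  iter k (@ds R) (fun u => u * f u) 0 = k%:R * iter k.-1 (@ds R) f 0.
Proof.
by move=> d0 fS; rewrite (@iter_ds_idM d) ?mul0r ?add0r //; exact: halfopen0.
Qed.

(** A zero of order [m] at the end point of the interval kills all derivatives of
    lower order. *)
Lemma iter_ds_expM0 d f m j : 0 < d -> smooth1 d f -> (j < m)%N ->
  iter j (@ds R) (fun u => u ^+ m * f u) 0 = 0.
Proof.
move=> d0 fS; elim: m j => // m IH j jm.
under eq_fun do rewrite exprS -mulrA.
rewrite (@iter_ds_id0 d) //; last first.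
  apply: smooth1M => //.
  exact: smooth1X.
by case: j jm => [|j] jm; rewrite ?mul0r // IH ?mulr0.
Qed.

(** The mean value theorem on [[a, s]] with [a > 0], where derivatives are
    two-sided, followed by the limit [a -> 0]. *)
Lemma smooth1_linear d f : smooth1 d f -> f 0 = 0 ->
  (forall s, halfopen d s -> ds f s = 1) -> forall s, halfopen d s -> f s = s.
Proof.
move=> fS f0 f1 s [s0 sd]; have [->//|sN0] := eqVneq s 0.
have {}s0 : 0 < s by rewrite lt_def sN0.
have fd u : halfopen d u -> diff_quot halfline (f : R^o -> R) 1 u --> (1 : R).
  move=> Uu; rewrite -{2}(f1 _ Uu).
  exact: (smooth_along_diff fS (i := tt) Uu).
have fin u : 0 < u < d -> is_derive (u : R^o) (1 : R^o) (f : R^o -> R^o) 1.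
  move=> /andP[u0 ud].
  have Uu : halfopen d u by split=> //; exact: ltW.
  (* away from the end point, 0 <= u + t holds on both sides of t = 0 *)
  have nA : \forall t \near (0 : R)^', halfline (u + t *: (1 : R^o)).
    near=> t; rewrite /halfline /= [t *: _]mulr1 -lerBlDl sub0r.
    have : `|t| < u by near: t; exact: dnbhs0_lt.
    by rewrite ltr_norml => /andP[/ltW].
  have c1 : h^-1 *: (((f : R^o -> R^o) \o shift u) (h *: (1 : R^o)) - f u)
      @[h --> (0 : R)^'] --> (1 : R).
    move=> P P1.
    have h : (0 : R)^' (fun t => halfline (u + t *: (1 : R^o)) ->
        P (t^-1 * (f (u + t *: (1 : R^o)) - f u))) := fd u Uu P P1.
    suff : (0 : R)^' (fun t => P (t^-1 * (f (t *: (1 : R^o) + u) - f u))) by [].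
    apply: (filterS _ (filterI h nA)) => t [Pt At].
    by rewrite [_ + u]addrC; exact: Pt.
  split; first by apply/cvg_ex; exists 1.
  exact: cvg_lim c1.
have fa a : 0 < a < s -> f a - a = f s - s.
  move=> /andP[a0 aS].
  have dab x : x \in `[a, s]%R -> is_derive (x : R^o) (1 : R^o) (f : R^o -> R^o) 1.
    move=> /itvP xas; apply: fin; rewrite (lt_le_trans a0) ?xas //=.
    by apply: le_lt_trans sd; rewrite xas.
  have cf : {within `[a, s], continuous (f : R -> R)}.
    by apply: (@derivable_within_continuous R R^o f) => x /dab[].
  have dao x : x \in `]a, s[%R -> is_derive (x : R^o) (1 : R^o) (f : R^o -> R^o) 1.
    by move=> xas; apply: dab; exact: subset_itv_oo_cc.
  have [c _] := MVT aS dao cf.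
  by rewrite mul1r => h; rewrite -[f s](subrK (f a)) h addrAC (addrAC s) subrr add0r addrC.
have U0 : halfopen d 0 by apply: halfopen0; exact: lt_trans sd.
have [pF nU] := halfopen_dir_open d 0 tt U0.
have c0 := diff_quot_continuous (fd 0 U0).
pose proof (cvgB c0 (dir_nbhs_cvg0 halfline (1 : R^o) 0)) as c1.
have c2 : (fun=> f s - s) @ dir_nbhs halfline (1 : R^o) 0 --> f 0 - 0.
  apply: (cvg_near_eq c1); near=> t; rewrite fctE /=.
  have ts : `|t| < s.
    by near: t; exact: (cvg_within _ (dnbhs0_lt s0)).
  have tN0 : t != 0 by near: t; exact: dir_nbhs_neq0.
  have : halfline (0 + t *: (1 : R^o)) by near: t; exact: withinT.
  rewrite /halfline /= add0r [t *: _]mulr1 => t0; rewrite fa // lt_def tN0 t0 /=.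
  by rewrite (le_lt_trans (ler_norm t)).
have c3 : (fun=> f s - s) @ dir_nbhs halfline (1 : R^o) 0 --> f s - s.
  exact: cvg_cst.
have e : f 0 - 0 = f s - s by apply: (cvg_unique (@norm_hausdorff _ R^o) c2 c3).
by apply/eqP; rewrite -subr_eq0 -e f0 subr0.
Unshelve. all: by end_near. Qed.

End OneVariable.
Arguments halfopen_dir_open {R} d.

(** * The differential identity along a curve *)

Section ScalarIdentity.
Variable R : realType.
Implicit Types (d s : R) (f g : R -> R).

Lemma iter_dsZ d c f k s : smooth1 d f -> halfopen d s ->
  iter k (@ds R) (fun u => c * f u) s = c * iter k (@ds R) f s.
Proof.
move=> fS; elim: k f fS => // k IH f fS Us; rewrite !iterSr.
rewrite (@iter_ds_ext _ d _ (fun u => c * ds f u)) ?inE //.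
- by apply: IH => //; exact: smooth1_ds.
- move=> u; rewrite inE => Uu.
  rewrite (@dsM _ d (fun=> c) f) ?(@ds_cst _ d) ?mul0r ?add0r //.
  exact: smooth1_cst.
- apply: smooth1_ds; apply: smooth1M => //.
  exact: smooth1_cst.
Qed.

(** The differential identity is an equality between [n rho] and a sum of a
    multiple of [s], the function [- w] and a remainder that vanishes to order
    [n] at 0; the derivatives of these three parts are computed separately. *)
Lemma iterated_identity d n k (rho J w T : R -> R) :
  0 < d -> smooth1 d rho -> smooth1 d J -> smooth1 d w -> smooth1 d T ->
  (1 <= k <= n.-1)%N ->
  (forall s, halfopen d s ->
     n%:R * rho s =
     s * (ds rho s + 2 * (rho s * w s) - J s) - w s
     - (s ^+ n.+1 * (T s * w s) + 2^-1 * ds (fun u => u ^+ n.+1 * T u) s)) ->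
  (n%:R - k%:R) * iter k (@ds R) rho 0 =
    - iter k (@ds R) w 0
    + 2 * (\sum_(1 <= j < k.+1)
             j%:R * 'C(k, j)%:R * iter j.-1 (@ds R) rho 0
             * iter (k - j) (@ds R) w 0)
    - k%:R * iter k.-1 (@ds R) J 0.
Proof.
move=> d0 rhoS JS wS TS /andP[k1 kn] eqn.
have U0 := halfopen0 d0.
have cS c : smooth1 d (fun=> c) by exact: smooth1_cst.
have XS m : smooth1 d (fun u => u ^+ m).
  exact: smooth1X.
have iS : smooth1 d (fun u => u) by exact: smooth1_id.
have rwS := smooth1M rhoS wS.
have TwS := smooth1M TS wS.
have XTS := smooth1M (XS n.+1) TS.
have rho'S := smooth1_ds rhoS.
have kn1 : (k.+1 < n.+1)%N.
  by rewrite ltnS; case: n kn {eqn XTS} => [|n] //=; case: (k) k1.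
have bS : smooth1 d (fun u => ds rho u + (2 * (rho u * w u) + (-1) * J u)).
  by apply: smooth1D => //; apply: smooth1D; apply: smooth1M.
have eS : smooth1 d (fun u => (-1) * (u ^+ n.+1 * (T u * w u))
      + (- 2^-1) * ds (fun u => u ^+ n.+1 * T u) u).
  by apply: smooth1D; apply: smooth1M => //; [exact: smooth1M|exact: smooth1_ds].
have wS' : smooth1 d (fun u => (-1) * w u) by exact: smooth1M.
have e1 : iter k (@ds R) (fun u => n%:R * rho u) 0 = iter k (@ds R)
   (fun u => u * (ds rho u + (2 * (rho u * w u) + (-1) * J u)) + ((-1) * w u
     + ((-1) * (u ^+ n.+1 * (T u * w u))
        + (- 2^-1) * ds (fun u => u ^+ n.+1 * T u) u))) 0.
  apply: (@iter_ds_ext _ d); rewrite ?inE //; last exact: smooth1M.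
  by move=> u; rewrite inE => Uu; rewrite eqn //; field.
have JS' : smooth1 d (fun u => (-1) * J u) by exact: smooth1M.
have rwS' : smooth1 d (fun u => 2 * (rho u * w u)) by exact: smooth1M.
have eb : iter k.-1 (@ds R)
    (fun u => ds rho u + (2 * (rho u * w u) + (-1) * J u)) 0 =
    iter k (@ds R) rho 0 + (2 * iter k.-1 (@ds R) (fun u => rho u * w u) 0
    - iter k.-1 (@ds R) J 0).
  rewrite (iter_dsD _ rho'S (smooth1D rwS' JS') U0) -iterSr prednK //.
  by rewrite (iter_dsD _ rwS' JS' U0) !(@iter_dsZ d) // mulN1r.
have ee : iter k (@ds R) (fun u => (-1) * (u ^+ n.+1 * (T u * w u))
      + (- 2^-1) * ds (fun u => u ^+ n.+1 * T u) u) 0 = 0.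
  have XTwS := smooth1M (XS n.+1) TwS; have XTS' := smooth1_ds XTS.
  rewrite (iter_dsD _ (smooth1M (cS _) XTwS) (smooth1M (cS _) XTS') U0).
  rewrite !(@iter_dsZ d) // -iterSr (iter_ds_expM0 d0 TwS (ltnW kn1)).
  by rewrite (iter_ds_expM0 d0 TS kn1) !mulr0 addr0.
have e : n%:R * iter k (@ds R) rho 0 = k%:R * (iter k (@ds R) rho 0 +
    (2 * iter k.-1 (@ds R) (fun u => rho u * w u) 0 - iter k.-1 (@ds R) J 0))
    - iter k (@ds R) w 0.
  move: e1; rewrite (@iter_dsZ d) // => ->.
  rewrite (iter_dsD _ (smooth1M iS bS) (smooth1D wS' eS) U0).
  rewrite (iter_dsD _ wS' eS U0) (iter_ds_id0 _ d0 bS) eb ee addr0.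
  by rewrite (@iter_dsZ d) // mulN1r.
rewrite (iter_dsM _ rhoS wS U0) in e.
rewrite mulrBl e.
have -> : \sum_(1 <= j < k.+1) j%:R * 'C(k, j)%:R * iter j.-1 (@ds R) rho 0
             * iter (k - j) (@ds R) w 0 =
   k%:R * \sum_(i < k.-1.+1) 'C(k.-1, i)%:R * iter i (@ds R) rho 0
             * iter (k.-1 - i) (@ds R) w 0.
  rewrite big_add1 big_mkord prednK // mulr_sumr; apply: eq_bigr => i _.
  have ki a : (k - a.+1 = k.-1 - a)%N by rewrite -subn1 -subnDA add1n.
  by rewrite ki !mulrA -!natrM mul_bin_diag.
ring.
Qed.

(** Differentiating [al ^ 2 = 1 - 2 s rho + s ^ n.+1 T] expresses the derivative
    of [al] through that of [rho]; one of the resulting [n + 1] copies of [rho]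
    cancels. *)
Lemma first_order_identity d n (al be rho J w T : R -> R) s :
  smooth1 d al -> smooth1 d be -> smooth1 d rho -> smooth1 d T ->
  (forall u, halfopen d u ->
     al u ^+ 2 + 2 * u * rho u = 1 + u ^+ n.+1 * T u) ->
  halfopen d s -> be s != 0 ->
  n.+1%:R * rho s =
    - (al s / be s * ds (fun u => al u * be u) s) - s * J s ->
  w s = ds be s / be s ->
  n%:R * rho s =
    s * (ds rho s + 2 * (rho s * w s) - J s) - w s
    - (s ^+ n.+1 * (T s * w s) + 2^-1 * ds (fun u => u ^+ n.+1 * T u) s).
Proof.
move=> alS beS rhoS TS SY Us be0 rhoE wE.
have cS a : smooth1 d (fun=> a) by exact: smooth1_cst.
have idS : smooth1 d (fun u => u) by exact: smooth1_id.
have irS : smooth1 d (fun u => u * rho u) by exact: smooth1M.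
have XS : smooth1 d (fun u => u ^+ n.+1 * T u).
  by apply: smooth1M => //; exact: smooth1X.
have E1 u : halfopen d u ->
    al u * al u = 1 + (u ^+ n.+1 * T u + (- 2) * (u * rho u)).
  by move=> /SY; rewrite -expr2 => e; apply: (addIr (2 * u * rho u)); rewrite e; ring.
have E2 : 2 * (al s * ds al s) =
    ds (fun u => u ^+ n.+1 * T u) s - 2 * (rho s + s * ds rho s).
  have e : ds (fun u => al u * al u) s =
      ds (fun u => 1 + (u ^+ n.+1 * T u + (- 2) * (u * rho u))) s.
    apply: (@ds_ext _ d); rewrite ?inE //; last exact: smooth1M.
    by move=> u; rewrite inE; exact: E1.
  rewrite (dsM alS alS Us) (dsD (cS _) (smooth1D XS (smooth1M (cS _) irS)) Us) in e.
  rewrite (dsD XS (smooth1M (cS _) irS) Us) (dsM (cS _) irS Us) in e.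
  rewrite (dsM idS rhoS Us) !(@ds_cst _ d) // (@ds_id _ d) // in e.
  rewrite mul0r !add0r mul1r in e.
  by rewrite -mulNr -e; ring.
have LE : al s / be s * ds (fun u => al u * be u) s =
    2^-1 * (2 * (al s * ds al s)) + al s * al s * w s.
  by rewrite (dsM alS beS Us) wE; field.
rewrite LE E1 // E2 -natr1 mulrDl mul1r in rhoE.
have -> : n%:R * rho s = n%:R * rho s + rho s - rho s by rewrite addrK.
by rewrite rhoE; field.
Qed.

End ScalarIdentity.

(** * Smooth functions on open subsets of the half-space *)

Section HalfSpace.
Variables (R : realType) (m : nat).
Implicit Types (O : set 'rV[R]_m.+1) (f F : 'rV[R]_m.+1 -> R).

Definition basis_dir (i : 'I_m.+1) : 'rV[R]_m.+1 := delta_mx ord0 i.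

Definition smoothH O f :=
  smooth_along (half_space (m := m)) basis_dir (half_space (m := m) `&` O) f.

Lemma half_space_dir_open O : open O ->
  dir_open (half_space (m := m)) basis_dir (half_space (m := m) `&` O).
Proof.
apply: dir_open_relative => z i t; rewrite /half_space /= !mxE => z0 t0.
by rewrite addr_ge0 // mulr_ge0 ?ler0n ?ltW.
Qed.

(** On an open set the derivative relative to the half-space is the ordinary one,
    whose difference quotients converge along a larger set of increments. *)
Lemma Ck_smooth_upto k W O F : open O -> O `<=` W -> Ck k W F ->
  smooth_upto (half_space (m := m)) basis_dir k (half_space (m := m) `&` O) F.
Proof.
move=> oO OW; elim: k F => // k IH F [_ dF].
apply: (smooth_upto_der (half_space_dir_open oO)
  (F := fun i z => 'D_(basis_dir i) F z)) => [z i [_ /OW Wz]|i]; last first.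
  by apply: IH; have [_] := dF i.
have [/(_ z Wz) dFz _] := dF i.
apply: (diff_quot_intro
  (u := fun h => h^-1 * ((F \o shift z) (h *: basis_dir i) - F z))).
  by apply: cvg_within_filter; exact: dFz.
by apply: filterE => t; rewrite /= [_ + z]addrC.
Qed.

Lemma smooth_on_smoothH O f : open O ->
  smooth_on (half_space (m := m) `&` O) f -> smoothH O f.
Proof.
move=> oO fS k; apply: smooth_upto_local => z /fS[W [F [oW Wz FC fF]]].
exists W => //; rewrite -setIA.
have oOW : open (O `&` W) by exact: openI.
apply: (smooth_upto_ext (half_space_dir_open oOW) (f := F)).
  by move=> y; rewrite inE => -[Hy [Oy Wy]]; rewrite fF.
by apply: (Ck_smooth_upto oOW _ (FC k)) => y [].
Qed.

Lemma set_coord0D (z : 'rV[R]_m.+1) s t :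
  set_coord0 s z + t *: basis_dir ord0 = set_coord0 (s + t) z.
Proof.
apply/rowP => j; rewrite !mxE eqxx /=.
by case: (j == ord0); rewrite ?mulr1 ?mulr0 ?addr0.
Qed.

(** The derivative in the coordinate 0 at a point of a line in that direction is
    an ordinary one-sided derivative in the parameter of the line. *)
Lemma diff_quot_line f (z : 'rV[R]_m.+1) s :
  diff_quot (half_space (m := m)) f (basis_dir ord0) (set_coord0 s z) =
  diff_quot (halfline (R := R)) (fun u => f (set_coord0 u z)) (1 : R^o) s.
Proof.
have lineE t : set_coord0 s z + t *: basis_dir ord0 =
    set_coord0 (s + t *: (1 : R^o)) z by rewrite set_coord0D [t *: (1 : R^o)]mulr1.
have e1 : (fun t : R =>
    t^-1 * (f (set_coord0 s z + t *: basis_dir ord0) - f (set_coord0 s z))) =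
  (fun t => t^-1 * (f (set_coord0 (s + t *: (1 : R^o)) z) - f (set_coord0 s z))).
  by apply/funext => t; rewrite lineE.
have e2 : [set t : R | half_space (m := m) (set_coord0 s z + t *: basis_dir ord0)]
    = [set t : R | halfline (s + t *: (1 : R^o))].
  by apply/funext => t /=; rewrite lineE /half_space /halfline /= mxE eqxx.
by rewrite /diff_quot e1 e2.
Qed.

Lemma ds_line f (z : 'rV[R]_m.+1) s :
  ds (fun u => f (set_coord0 u z)) s = pd ord0 f (set_coord0 s z).
Proof. by rewrite /pd /wderive diff_quot_line. Qed.

Lemma smooth1_line O f (z : 'rV[R]_m.+1) d : open O ->
  (forall s, halfopen d s -> O (set_coord0 s z)) ->
  smoothH O f -> smooth1 d (fun s => f (set_coord0 s z)).
Proof.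
move=> oO lO fS k; elim: k f fS => // k IH f fS.
apply: (smooth_upto_der (halfopen_dir_open d)
  (F := fun _ s => pd ord0 f (set_coord0 s z))) => [s i Us|i]; last first.
  by apply: IH; exact: (smooth_along_wderive ord0 fS).
rewrite -[X in X --> _]diff_quot_line.
apply: (smooth_along_diff fS (i := ord0)); split; last exact: lO.
by rewrite /half_space /= mxE eqxx; case: Us.
Qed.

End HalfSpace.

(** * Charts of a manifold with boundary *)

Section Topology.
Variable R : realType.

(** The topology of row vectors is the product topology. *)
Lemma cvg_row (T : Type) (F : set_system T) {FF : Filter F} (m : nat)
    (f : T -> 'rV[R]_m) (l : 'rV[R]_m) :
  (forall j, f t ord0 j @[t --> F] --> l ord0 j) -> f @ F --> l.
Proof.
move=> fl P [/= Q Ql QP].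
have h : \forall t \near F, forall j, Q ord0 j (f t ord0 j).
  by apply: filter_forall => j; exact: (fl j _ (Ql ord0 j)).
apply: (filterS _ h) => t Qt; apply: QP => i j; rewrite ord1; exact: Qt.
Qed.

Lemma cvg_within_in (T : Type) (F : set_system T) {FF : Filter F}
    (Y : topologicalType) (f : T -> Y) (D : set Y) (y : Y) :
  f @ F --> y -> (\forall t \near F, D (f t)) -> f @ F `=>` within D (nbhs y).
Proof.
move=> fy fD P Py.
have h : F (f @^-1` (fun z => D z -> P z)) := fy _ Py.
by apply: (filterS _ (filterI h fD)) => t [+ Dt]; exact.
Qed.

Lemma set_coord0_cvg (T : Type) (F : set_system T) {FF : Filter F} (m : nat)
    (a : T -> R) (b : T -> 'rV[R]_m.+1) (a0 : R) (b0 : 'rV[R]_m.+1) :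
  a @ F --> a0 -> b @ F --> b0 ->
  set_coord0 (a t) (b t) @[t --> F] --> set_coord0 a0 b0.
Proof.
move=> aa bb; apply: cvg_row => j.
rewrite mxE; under eq_cvg do rewrite mxE.
case: ifP => _ //.
exact: (cvg_comp _ _ bb (@coord_continuous R 1 m.+1 ord0 j b0)).
Qed.

Lemma set_coord0_same (m : nat) (z : 'rV[R]_m.+1) : set_coord0 (z ord0 ord0) z = z.
Proof. by apply/rowP => j; rewrite mxE; case: eqP => // ->. Qed.

Lemma set_coord0_twice (m : nat) (s t : R) (z : 'rV[R]_m.+1) :
  set_coord0 s (set_coord0 t z) = set_coord0 s z.
Proof. by apply/rowP => j; rewrite !mxE; case: (j == ord0). Qed.

Lemma set_coord00 (m : nat) (s : R) (z : 'rV[R]_m.+1) :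
  set_coord0 s z ord0 ord0 = s.
Proof. by rewrite mxE eqxx. Qed.

End Topology.

Section Charts.
Variables (R : realType) (m : nat) (X : topologicalType).
Variable mX : bmanifold R m X.

Lemma chart_open c : atlas mX c -> exists2 O : set 'rV[R]_m.+1,
  open O & coord c @` dom c = half_space (m := m) `&` O.
Proof. by move=> /atlas_chart[_ h _ _ _]. Qed.

Lemma inv_coord c p : atlas mX c -> dom c p -> inv c (coord c p) = p.
Proof. by move=> /atlas_chart[_ _ h _ _]; exact: h. Qed.

(** Invariance of the boundary under change of charts: [boundary] only provides
    some chart in which the coordinate 0 vanishes.  If it were positive in the
    chart [c], then [p] would be an interior minimum of [sigma] there, and all
    partial derivatives of [sigma] at [p] would vanish. *)
Lemma boundary_coord0 (sigma : X -> R) c p : boundary_defining mX sigma ->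
  atlas mX c -> dom c p -> boundary mX p -> coord c p ord0 ord0 = 0.
Proof.
move=> [sS s0 sgt sd] ac dp bp.
have [U oU imc] := chart_open ac.
set z := coord c p.
have [z0 Uz] : (half_space (m := m) `&` U) z by rewrite -imc; exists p.
apply/eqP/negP => /negP zN0.
have {z0}z0 : 0 < z ord0 ord0 by rewrite lt_def zN0; exact: z0.
have [i] := sd c p ac dp bp; rewrite /cpd /pd -/z => /negP; apply.
set phi := sigma \o inv c.
have phiS : smoothH U phi.
  by apply: smooth_on_smoothH => //; have := sS c ac; rewrite setIT imc.
have Uz' : (half_space (m := m) `&` U) z by split=> //; exact: ltW.
have := smooth_along_diff phiS (i := i) Uz'.
set l := wderive _ _ _ _ => phil.
have phi0 : phi z = 0 by rewrite /phi /= inv_coord //; apply/s0.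
have phige y : 0 <= phi y.
  rewrite /phi /=; have [/s0->//|/sgt/ltW//] := pselect (boundary mX (inv c y)).
have nH : \forall t \near (0 : R)^', half_space (m := m) (z + t *: basis_dir R i).
  near=> t; rewrite /half_space /= !mxE.
  have tz : `|t| < z ord0 ord0 by near: t; exact: dnbhs0_lt.
  case: (_ && _); rewrite ?mulr1 ?mulr0 ?addr0; last exact: ltW.
  by rewrite -lerBlDl sub0r; move: tz; rewrite ltr_norml => /andP[/ltW].
have dq P : nbhs l P -> (0 : R)^' (fun t => P (t^-1 * phi (z + t *: basis_dir R i))).
  move=> /phil h.
  have h' : (0 : R)^' (fun t => half_space (m := m) (z + t *: basis_dir R i) ->
    P (t^-1 * (phi (z + t *: basis_dir R i) - phi z))) := h.
  apply: (filterS _ (filterI h' nH)) => t [+ Ht] => /(_ Ht).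
  by rewrite phi0 subr0.
apply/eqP; have [ll|ll|//] := ltgtP l 0; exfalso.
- have h : \forall t \near (0 : R), t != 0 ->
    t^-1 * phi (z + t *: basis_dir R i) < 0 :=
    dq [set y | y < 0] (open_nbhs_nbhs (conj (@open_lt _ 0) ll)).
  have h2 : (0 : R)^'+ (fun t => t^-1 * phi (z + t *: basis_dir R i) < 0).
    by apply: filterS h => t Pt t0; apply: Pt; rewrite gt_eqF.
  have [t [t0 +]] := filter_ex (filterI (nbhs_right_gt 0) h2).
  by rewrite ltNge mulr_ge0 // invr_ge0 ltW.
- have h : \forall t \near (0 : R), t != 0 ->
    0 < t^-1 * phi (z + t *: basis_dir R i) :=
    dq [set y | 0 < y] (open_nbhs_nbhs (conj (@open_gt _ 0) ll)).
  have h2 : (0 : R)^'- (fun t => 0 < t^-1 * phi (z + t *: basis_dir R i)).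
    by apply: filterS h => t Pt t0; apply: Pt; rewrite lt_eqF.
  have [t [t0 +]] := filter_ex (filterI (nbhs_left_lt 0) h2).
  by rewrite ltNge mulr_le0_ge0 // invr_le0 ltW.
Unshelve. all: by end_near. Qed.

End Charts.

(** * The adapted chart *)

Section AdaptedChart.
Variables (R : realType) (m : nat) (X : topologicalType).
Variables (mX : bmanifold R m X) (sigma : X -> R).
Hypothesis sigma_bdf : boundary_defining mX sigma.

Lemma smooth_on_sub (A B : set 'rV[R]_m.+1) f :
  A `<=` B -> smooth_on B f -> smooth_on A f.
Proof.
move=> AB fB z /AB/fB[N [F [oN Nz FC fF]]]; exists N, F; split=> // w /AB Bw.
exact: fF.
Qed.

(** The chart is [collar_chart c0] transported by the diffeomorphism [eta].  That
    it is a chart uses the continuity of [eta] and of its inverse, and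
    [boundary_coord0], which makes a point of the boundary in [dom c0]
    recoverable from its tangential coordinates.  Its transitions with the atlas
    are the coordinate expressions of [eta] and of its inverse, so maximality
    puts it in the atlas. *)
Lemma exists_adapted_chart (eps : R) (eta : R -> X -> X) (W : set X) c0 :
  open W ->
  diffeo (collar_atlas mX eps) (atlas mX) (collar mX eps) W
    (fun q => eta q.1 q.2) ->
  atlas mX c0 ->
  exists2 c, atlas mX c &
    (forall s x, 0 <= s < eps -> boundary mX x -> dom c0 x ->
      dom c (eta s x) /\ coord c (eta s x) = set_coord0 s (coord c0 x)) /\
    (forall p, dom c p -> exists s x,
      [/\ 0 <= s < eps, boundary mX x, dom c0 x & p = eta s x]).
Proof.
move=> oW [imE [finv [finvK [etaC etaS] [finvC finvS]]]] ac0.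
have [U0 oO0 im0] := chart_open ac0.
have [oD0 _ inv0 cC0 iC0] := atlas_chart ac0.
pose cc := collar_chart mX eps c0.
have acc : collar_atlas mX eps cc by exists c0.
pose D := W `&` finv @^-1` [set q | dom c0 q.2].
pose c := Chart D (fun p => coord cc (finv p)) (fun z => eta (inv cc z).1 (inv cc z).2).
have WP p : W p -> collar mX eps (finv p) /\ eta (finv p).1 (finv p).2 = p.
  by rewrite -imE => -[q cq <-]; rewrite finvK.
have etaW s x : 0 <= s < eps -> boundary mX x ->
    W (eta s x) /\ finv (eta s x) = (s, x).
  move=> se bx; have cq : collar mX eps (s, x) by split.
  by split; [rewrite -imE; exists (s, x)|exact: (finvK _ cq)].
have cx0 x : boundary mX x -> dom c0 x -> coord c0 x ord0 ord0 = 0.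
  by move=> bx dx; exact: (boundary_coord0 sigma_bdf).
have ccK q : collar mX eps q -> dom c0 q.2 -> inv cc (coord cc q) = q.
  move=> [_ bq] dq; rewrite /cc /= set_coord00 set_coord0_twice.
  rewrite -[X in set_coord0 X _](cx0 _ bq dq) set_coord0_same inv0 //.
  by case: (q).
have dc s x : 0 <= s < eps -> boundary mX x -> dom c0 x ->
    dom c (eta s x) /\ coord c (eta s x) = set_coord0 s (coord c0 x).
  move=> se bx dx; have [We fe] := etaW _ _ se bx; split; last by rewrite /= fe.
  by split=> //; rewrite /= fe.
have cd p : dom c p -> exists s x,
    [/\ 0 <= s < eps, boundary mX x, dom c0 x & p = eta s x].
  move=> [Wp dp]; have [[se bq] ep] := WP _ Wp.
  exists (finv p).1, (finv p).2; split=> //; exact: esym.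
pose O := [set z : 'rV[R]_m.+1 | z ord0 ord0 < eps] `&`
          [set z | U0 (set_coord0 0 z)].
have cs0 : continuous (fun z : 'rV[R]_m.+1 => set_coord0 0 z).
  by move=> z; apply: (@set_coord0_cvg R _ (nbhs z) _ m (fun=> 0) id);
    [exact: cvg_cst|exact: cvg_id].
have imc : coord c @` dom c = half_space (m := m) `&` O.
  apply/seteqP; split=> [_ [p /cd[s [x [/andP[s0 se] bx dx ->]]] <-]|z].
    have [|_ ->] := dc s x _ bx dx; first by rewrite s0.
    rewrite /half_space /O /= set_coord00 set_coord0_twice; split=> //.
    rewrite -[X in set_coord0 X _](cx0 _ bx dx) set_coord0_same.
    by have [] : (half_space (m := m) `&` U0) (coord c0 x) by rewrite -im0; exists x.
  move=> [z0 [ze Oz]].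
  have : (half_space (m := m) `&` U0) (set_coord0 0 z).
    by split=> //; rewrite /half_space /= set_coord00.
  rewrite -im0 => -[x dx xz].
  have bx : boundary mX x by exists c0 => //; rewrite xz set_coord00.
  have se : 0 <= z ord0 ord0 < eps by apply/andP; split.
  have [dE cE] := dc _ _ se bx dx.
  by exists (eta (z ord0 ord0) x); rewrite ?cE ?xz ?set_coord0_twice ?set_coord0_same.
have oO : open O.
  apply: openI.
    apply: (@open_comp _ _ (fun z : 'rV[R]_m.+1 => z ord0 ord0) [set u | u < eps]).
      by move=> z _; exact: coord_continuous.
    exact: open_lt.
  by apply: (@open_comp _ _ (fun z : 'rV[R]_m.+1 => set_coord0 0 z) U0) => // z _.
have cfinv p : W p -> {for p, continuous finv}.
  move=> Wp; have := finvC; rewrite continuous_open_subspace // => h.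
  by apply: h; rewrite inE.
have oD : open D.
  rewrite openE => p [Wp dp]; apply: filterI; first exact: open_nbhs_nbhs.
  have h2 : (finv p').2 @[p' --> p] --> (finv p).2.
    exact: (cvg_comp _ _ (cfinv p Wp) cvg_snd).
  by apply: (h2 (dom c0)); exact: open_nbhs_nbhs.
have chc : is_chart c.
  split=> //.
  - by exists O.
  - move=> p [Wp dp]; have [cq ep] := WP _ Wp.
    rewrite -[LHS]/(eta (inv cc (coord cc (finv p))).1
      (inv cc (coord cc (finv p))).2).
    by rewrite ccK.
  - apply: continuous_in_subspaceT => p; rewrite inE => -[Wp dp].
    apply: set_coord0_cvg.
      exact: (cvg_comp _ _ (cfinv p Wp) cvg_fst).
    have h2 : (finv p').2 @[p' --> p] --> (finv p).2.
      exact: (cvg_comp _ _ (cfinv p Wp) cvg_snd).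
    apply: (cvg_comp _ _ h2).
    have := cC0; rewrite continuous_open_subspace // => h.
    by apply: h; rewrite inE.
  - apply/subspace_continuousP => z; rewrite imc => Hz.
    have FF : Filter (within (half_space (m := m) `&` O) (nbhs z)).
      exact: within_filter.
    set F := within _ _ in FF *.
    have HF : F (half_space (m := m) `&` O) by exact: withinT.
    have idF : id @ F --> z by exact: cvg_within.
    have inO y : (half_space (m := m) `&` O) y ->
        (coord c0 @` dom c0) (set_coord0 0 y) /\ collar mX eps (inv cc y).
      move=> [y0 [ye Oy]].
      have iy : (coord c0 @` dom c0) (set_coord0 0 y).
        by rewrite im0; split=> //; rewrite /half_space /= set_coord00.
      split=> //; split; first by apply/andP; split.
      have [x dx xy] := iy; exists c0 => //.
      by rewrite /= -xy inv0 // xy set_coord00.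
    have h1 : set_coord0 0 y @[y --> F] `=>`
        within (coord c0 @` dom c0) (nbhs (set_coord0 0 z)).
      apply: cvg_within_in; first exact: (cvg_comp _ _ idF (cs0 z)).
      by apply: (filterS _ HF) => y /inO[].
    have [iz cz] := inO _ Hz.
    have h2 : inv c0 (set_coord0 0 y) @[y --> F] --> inv c0 (set_coord0 0 z).
      by apply: (cvg_comp _ _ h1); move/subspace_continuousP : iC0; exact.
    have h3 : (fun y : 'rV[R]_m.+1 => y ord0 ord0) @ F --> z ord0 ord0.
      exact: (cvg_comp _ _ idF (@coord_continuous R 1 m.+1 ord0 ord0 z)).
    have h4 : inv cc @ F `=>` within (collar mX eps) (nbhs (inv cc z)).
      have h34 :
          (fun y : 'rV[R]_m.+1 => (y ord0 ord0, inv c0 (set_coord0 0 y))) @ F -->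
          (z ord0 ord0, inv c0 (set_coord0 0 z)).
        by pose proof (cvg_pair h3 h2) as hp; exact: hp.
      apply: (@cvg_within_in _ F FF); first exact: h34.
      by apply: (filterS _ HF) => y /inO[].
    have h5 : (fun q => eta q.1 q.2) @ within (collar mX eps) (nbhs (inv cc z))
        --> eta (inv cc z).1 (inv cc z).2.
      by move/subspace_continuousP : etaC; exact.
    exact: (cvg_comp _ _ h4 h5).
have tr c' : atlas mX c' -> smooth_transition c c' /\ smooth_transition c' c.
  move=> ac'; split=> a.
    apply: smooth_on_sub (etaS cc c' a acc ac').
    move=> _ [p [[Wp dp] dp'] <-]; exists (finv p) => //.
    have [cq ep] := WP _ Wp.
    by rewrite /= ep; split.
  apply: smooth_on_sub (finvS c' cc a ac' acc).
  move=> _ [p [dp' [Wp dp]] <-]; exists p => //.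
  by have [cq ep] := WP _ Wp; split.
by exists c => //; exact: atlas_max.
Qed.

End AdaptedChart.

(** * Positive definite matrices *)

Section PositiveDefinite.
Variable R : realType.

Definition posdef m (A : 'M[R]_m) :=
  forall u : 'rV[R]_m, u != 0 -> 0 < (u *m A *m u^T) ord0 ord0.

Lemma posdef_det_neq0 m (A : 'M[R]_m) : posdef A -> \det A != 0.
Proof.
move=> Apos; apply/det0P => -[u u0 uA].
by have := Apos u u0; rewrite uA mul0mx mxE ltxx.
Qed.

(** The determinant does not vanish on the segment from the identity to [A], which
    consists of positive definite matrices, and it is 1 at the identity. *)
Lemma posdef_det_gt0 m (A : 'M[R]_m) : posdef A -> 0 < \det A.
Proof.
move=> Apos.
pose P : 'M[{poly R}]_m := 'X *: map_mx polyC A + (1 - 'X)%:M.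
have PE t : (\det P).[t] = \det (t *: A + (1 - t)%:M).
  rewrite -horner_evalE -det_map_mx; congr (\det _).
  apply/matrixP => i j; rewrite !mxE /= horner_evalE !hornerE hornerMn !hornerE.
  by rewrite mulrC.
have P1 : (\det P).[1] = \det A.
  by rewrite PE scale1r subrr raddf0 addr0.
have P0 : (\det P).[0] = 1 by rewrite PE scale0r add0r subr0 det1.
have Pt t : 0 <= t <= 1 -> (\det P).[t] != 0.
  move=> /andP[t0 t1]; rewrite PE; apply: posdef_det_neq0 => u u0.
  rewrite mulmxDr mulmxDl mxE -scalemxAr -scalemxAl mxE mul_mx_scalar -scalemxAl.
  rewrite [in X in _ + X]mxE.
  have uu : 0 < (u *m u^T) ord0 ord0.
    have /rV0Pn[j uj] := u0.
    rewrite mxE (bigD1 j) //= mxE ltr_pwDl //.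
      by rewrite -expr2 lt_def sqr_ge0 expf_neq0.
    by apply: sumr_ge0 => i _; rewrite mxE -expr2 sqr_ge0.
  have [->|tN0] := eqVneq t 0; first by rewrite mul0r add0r subr0 mul1r.
  rewrite ltr_pwDl // ?mulr_ge0 ?subr_ge0 ?(ltW uu) //.
  by rewrite mulr_gt0 ?Apos // lt_def tN0.
(* otherwise the determinant changes sign on the segment *)
rewrite ltNge; apply/negP => A0.
have [|x x01 +] := @poly_ivt R (- \det P) 0 1 ler01.
  by rewrite !hornerN P1 P0 oppr_le0 ler01 oppr_ge0.
by rewrite rootN rootE; apply/negP/Pt.
Qed.

Lemma posdef_minor m (A : 'M[R]_m.+1) : posdef A -> posdef (row' ord0 (col' ord0 A)).
Proof.
move=> Apos u u0.
pose v : 'rV[R]_m.+1 := \row_j if unlift ord0 j is Some i then u ord0 i else 0.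
have v0 : v ord0 ord0 = 0 by rewrite mxE unlift_none.
have vl i : v ord0 (lift ord0 i) = u ord0 i by rewrite mxE liftK.
have vN0 : v != 0.
  apply: contra u0 => /eqP v00; apply/eqP/rowP => j.
  by rewrite -vl v00 !mxE.
have := Apos v vN0; congr (0 < _).
rewrite !mxE big_ord_recl [v^T _ _]mxE v0 mulr0 add0r; apply: eq_bigr => j _.
rewrite !mxE big_ord_recl v0 mul0r add0r liftK; congr (_ * _).
by apply: eq_bigr => i _; rewrite vl !mxE.
Qed.

Lemma posdef00 m (A : 'M[R]_m.+1) : posdef A -> 0 < A ord0 ord0.
Proof.
move=> Apos.
have e0 : delta_mx ord0 ord0 != 0 :> 'rV[R]_m.+1.
  apply/eqP => /rowP/(_ ord0)/eqP; rewrite !mxE eqxx /= oner_eq0 //.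
by have := Apos _ e0; rewrite trmx_delta -rowE -colE !mxE.
Qed.

(** If the column 0 of the inverse is a multiple of the first basis vector then so
    is that of [A], and the cofactor expansion along it has one term. *)
Lemma inv_block_col m (A : 'M[R]_m.+1) N : A \in unitmx ->
  (forall i, invmx A i ord0 = N * (i == ord0)%:R) ->
  A ord0 ord0 = N^-1 /\ \det A = N^-1 * \det (row' ord0 (col' ord0 A)).
Proof.
move=> uA invA.
have AN i : A i ord0 * N = (i == ord0)%:R.
  have := mulmxV uA => /matrixP/(_ i ord0); rewrite !mxE => <-.
  rewrite big_ord_recl invA eqxx mulr1 big1 ?addr0 // => j _.
  by rewrite invA mulr0n !mulr0.
have N0 : N != 0.
  apply/eqP => N0; have := AN ord0; rewrite N0 mulr0 eqxx.
  by move=> /esym/eqP; rewrite oner_eq0.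
have A00 : A ord0 ord0 = N^-1.
  by apply: (mulIf N0); rewrite AN eqxx mulVf.
split=> //; rewrite (expand_det_col A ord0) big_ord_recl big1 ?addr0 => [|j _].
  by rewrite A00 /cofactor expr0 mul1r.
have /eqP := AN (lift ord0 j); rewrite mulf_eq0 (negbTE N0) orbF => /eqP ->.
by rewrite mul0r.
Qed.

End PositiveDefinite.

(** * Geometry in the adapted chart *)

Section ChartCalculus.
Variables (R : realType) (m : nat) (X : topologicalType).
Variables (mX : bmanifold R m X) (g : metric mX).
Variables (c : chart R m X) (O : set 'rV[R]_m.+1).
Hypotheses (ac : atlas mX c) (oO : open O).
Hypothesis imc : coord c @` dom c = half_space (m := m) `&` O.

Let oH := half_space_dir_open oO.
Let cimg := half_space (m := m) `&` O.

Lemma chart_imgP z : cimg z -> dom c (inv c z) /\ coord c (inv c z) = z.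
Proof. by rewrite /cimg -imc => -[p dp <-]; rewrite (inv_coord ac). Qed.

Definition smoothX (f : X -> R) := smoothH O (f \o inv c).

(** A coordinate derivative at the points [inv c z] is the partial derivative of
    the coordinate expression; this lets smoothness pass to iterated coordinate
    derivatives such as the Christoffel symbols and the curvature. *)
Lemma cpd_inv i f z : cimg z -> cpd c i f (inv c z) = pd i (f \o inv c) z.
Proof. by move=> /chart_imgP[_ e]; rewrite /cpd e. Qed.

Lemma smoothX_cpd i f : smoothX f -> smoothX (cpd c i f).
Proof.
move=> fS; have := smooth_along_wderive i fS.
by apply: (smooth_along_ext oH) => z; rewrite inE => Uz; rewrite /= cpd_inv.
Qed.

Lemma smoothX_fun W f : smooth_fun mX W f -> dom c `<=` W -> smoothX f.
Proof.
move=> fS dW; apply: smooth_on_smoothH => //; have := fS c ac.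
by rewrite (setIidl dW) imc.
Qed.

Lemma smoothX_metric i j : smoothX (fun p => g c p i j).
Proof.
by apply: smooth_on_smoothH => //; have := gcomp_smooth g i j ac; rewrite imc.
Qed.

Lemma metric_posdef p : dom c p -> posdef (g c p).
Proof. by move=> dp u u0; exact: (gcomp_pos g ac dp u0). Qed.

Lemma metric_unit p : dom c p -> g c p \in unitmx.
Proof. by move=> /metric_posdef/posdef_det_neq0; rewrite unitmxE unitfE. Qed.

Lemma smoothX_ginv i j : smoothX (ginv g c i j).
Proof.
apply: (smooth_along_invmx oH (M := fun z => g c (inv c z))).
  by move=> z /chart_imgP[dz _]; exact/posdef_det_neq0/metric_posdef.
by move=> a b; exact: smoothX_metric.
Qed.

Lemma smoothX_christoffel k i j : smoothX (christoffel g c k i j).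
Proof.
apply: (smooth_alongM oH); first exact: (smooth_along_cst oH).
apply: (smooth_along_sum oH) => l; apply: (smooth_alongM oH (smoothX_ginv k l)).
apply: (smooth_alongB oH); first apply: (smooth_alongD oH);
  exact/smoothX_cpd/smoothX_metric.
Qed.

Lemma smoothX_scal : smoothX (scal g c).
Proof.
apply: (smooth_along_sum oH) => j; apply: (smooth_along_sum oH) => k.
apply: (smooth_alongM oH (smoothX_ginv j k)).
apply: (smooth_along_sum oH) => i; apply: (smooth_alongD oH).
  by apply: (smooth_alongB oH); exact/smoothX_cpd/smoothX_christoffel.
apply: (smooth_along_sum oH) => l; apply: (smooth_alongB oH);
  by apply: (smooth_alongM oH); exact: smoothX_christoffel.
Qed.

End ChartCalculus.

Lemma chart_preimage_open (R : realType) (m : nat) (X : topologicalType)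
    (mX : bmanifold R m X) (c : chart R m X) (W : set X) :
  atlas mX c -> open W ->
  exists2 V : set 'rV[R]_m.+1, open V &
    coord c @` (dom c `&` W) = coord c @` dom c `&` V.
Proof.
move=> ac oW; have [_ _ invK _ /continuousP/(_ W oW)/open_subspaceP[V oV VE]] :=
  atlas_chart ac.
exists V => //; rewrite [RHS]setIC VE; apply/seteqP; split=> z.
  move=> [p [dp Wp] <-]; split; last by exists p.
  have : W (inv c (coord c p)) by rewrite invK.
  by [].
by move=> [Wz [p dp pz]]; exists p => //; split=> //; rewrite -(invK p) // pz.
Qed.

(** The chart [c] of [X] reads a point [eta s x] as [s] followed by the
    tangential coordinates of [x] in [c0]; [eta] is the flow whose velocity is
    the normalized gradient, required here in the coordinates [c] only. *)
Record adapted_chart (R : realType) (m : nat) (X : topologicalType)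
    (mX : bmanifold R m X) (g : metric mX) (sigma : X -> R) (eps : R)
    (eta : R -> X -> X) (c0 c : chart R m X) : Prop := AdaptedChart {
  adapted_base_atlas : atlas mX c0;
  adapted_atlas : atlas mX c;
  adapted_eps_gt0 : 0 < eps;
  adapted_eta0 : forall x, boundary mX x -> eta 0 x = x;
  adapted_flow : forall s x (i : 'I_m.+1), 0 <= s < eps -> boundary mX x ->
    dom c (eta s x) ->
    diff_quot (halfline (R := R)) (fun u => coord c (eta u x) ord0 i) 1 s
      --> normalized_grad g sigma c i (eta s x);
  adapted_coord : forall s x, 0 <= s < eps -> boundary mX x -> dom c0 x ->
    dom c (eta s x) /\ coord c (eta s x) = set_coord0 s (coord c0 x);
  adapted_cover : forall p, dom c p -> exists s x,
    [/\ 0 <= s < eps, boundary mX x, dom c0 x & p = eta s x] }.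

Lemma adapted_chart_exists (R : realType) (m : nat) (X : topologicalType)
    (mX : bmanifold R m X) (g : metric mX) (sigma : X -> R) (eps : R)
    (eta : R -> X -> X) (c0 : chart R m X) :
  boundary_defining mX sigma -> adapted_coordinates g sigma eps eta ->
  atlas mX c0 -> exists c, adapted_chart g sigma eps eta c0 c.
Proof.
move=> sigma_bdf [eps0 eta0 flow [W [oW _ etaW]]] ac0.
have [c ac [c_eta c_dom]] := exists_adapted_chart sigma_bdf oW etaW ac0.
by exists c; split=> // s x i se bx; exact: flow.
Qed.

Section AdaptedGeometry.
Variables (R : realType) (m : nat) (X : topologicalType).
Variables (mX : bmanifold R m X) (g : metric mX) (sigma : X -> R).
Variables (eps : R) (eta : R -> X -> X) (c0 c : chart R m X).
Variable O : set 'rV[R]_m.+1.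
Hypotheses (sigma_bdf : boundary_defining mX sigma).
Hypothesis ad : adapted_chart g sigma eps eta c0 c.
Hypothesis oO : open O.
Hypothesis imc : coord c @` dom c = half_space (m := m) `&` O.

Let ac0 := adapted_base_atlas ad.
Let ac := adapted_atlas ad.
Let eps0 := adapted_eps_gt0 ad.
Let eta0 := adapted_eta0 ad.
Let flow := adapted_flow ad.
Let c_eta := adapted_coord ad.
Let c_dom := adapted_cover ad.
Let cimg := half_space (m := m) `&` O.

(** In the adapted chart the flow line through a point is the straight line in the
    direction of the coordinate 0, so the limit of its difference quotients is
    known. *)
Lemma normalized_gradE p i : dom c p ->
  normalized_grad g sigma c i p = (i == ord0)%:R.
Proof.
move=> dp; have [s [x [se bx dx pe]]] := c_dom dp.
have fl := flow (i := i) se bx; rewrite -pe in fl; have {}fl := fl dp.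
have [s0 s1] := andP se.
have Us : halfopen eps s by [].
have [pF nU] := halfopen_dir_open eps s tt Us.
have {}fl := cvg_lim (@norm_hausdorff _ R^o) (FF := fmap_proper_filter _ pF) fl.
rewrite -fl; apply: (cvg_lim (@norm_hausdorff _ R^o) (FF := fmap_proper_filter _ pF)).
apply: (@cvg_near_eq _ _ _ (fun=> (i == ord0)%:R)); first exact: cvg_cst.
near=> t.
have [t0 te] : halfopen eps (s + t *: (1 : R^o)) by near: t.
have [_ ->] := @c_eta (s + t *: (1 : R^o)) x (introT andP (conj t0 te)) bx dx.
have [_ ->] := c_eta se bx dx.
have tN0 : t != 0.
  by near: t; exact: (@dir_nbhs_neq0 _ _ _ (1 : R^o) s).
rewrite !mxE; case: (i == ord0); last by rewrite subrr mulr0.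
by rewrite addrAC subrr add0r [t *: _]mulr1 mulVf.
Unshelve. all: by end_near. Qed.

Lemma norm2_dE p : norm2_d g c sigma p =
  \sum_i cpd c i sigma p * grad g c sigma i p.
Proof.
apply: eq_bigr => i _; rewrite /grad mulr_sumr; apply: eq_bigr => j _; ring.
Qed.

(** Where the norm vanishes, the normalized gradient is a division by zero, whose
    value 0 contradicts [normalized_gradE]. *)
Lemma norm2_d_neq0 p : dom c p -> norm2_d g c sigma p != 0.
Proof.
move=> dp; apply/eqP => N0.
have := normalized_gradE ord0 dp; rewrite /normalized_grad N0 invr0 mulr0 eqxx.
by move/esym/eqP; rewrite oner_eq0.
Qed.

Lemma grad_adapted p i : dom c p ->
  grad g c sigma i p = norm2_d g c sigma p * (i == ord0)%:R.
Proof.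
move=> dp; rewrite -(normalized_gradE i dp) /normalized_grad mulrC divfK //.
exact: norm2_d_neq0.
Qed.

(** [d sigma] applied to [grad sigma = |d sigma|^2 d/ds] is [|d sigma|^2]. *)
Lemma cpd0_sigma p : dom c p -> cpd c ord0 sigma p = 1.
Proof.
move=> dp; apply: (mulIf (norm2_d_neq0 dp)); rewrite mul1r {2}norm2_dE.
rewrite (bigD1 ord0) //= grad_adapted // eqxx mulr1 big1 ?addr0 // => i i0.
by rewrite grad_adapted // (negbTE i0) !mulr0.
Qed.

Lemma line_img z s : cimg z -> 0 <= s < eps ->
  cimg (set_coord0 s z) /\
  inv c (set_coord0 s z) = eta s (inv c (set_coord0 0 z)).
Proof.
rewrite /cimg -{1}imc => -[p dp <-] se; have [t [x [te bx dx ->]]] := c_dom dp.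
have [_ ->] := c_eta te bx dx; rewrite !set_coord0_twice.
have [d1 <-] := c_eta se bx dx.
have [d2 <-] := @c_eta 0 x (introT andP (conj (lexx 0) eps0)) bx dx.
rewrite !(inv_coord ac) // eta0 //; split=> //.
by rewrite -imc; exists (eta s x).
Qed.

Lemma line_bdry z : cimg z -> boundary mX (inv c (set_coord0 0 z)).
Proof.
move=> Uz; have se : 0 <= (0 : R) < eps by rewrite lexx.
have [/(chart_imgP ac imc)[d e] _] := line_img Uz se.
by exists c => //; rewrite e set_coord00.
Qed.

(** On each line in the direction 0, [sigma] starts from 0 and has derivative 1. *)
Lemma sigma_coord0 z : cimg z -> sigma (inv c z) = z ord0 ord0.
Proof.
move=> Uz; have [Hz Oz] := Uz.
have sS : smoothX c O sigma.
  have [sS _ _ _] := sigma_bdf.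
  by apply: (smoothX_fun ac oO imc sS).
have lO s : halfopen eps s -> cimg (set_coord0 s z).
  by move=> [s0 s1]; have [] := line_img Uz (introT andP (conj s0 s1)).
have lS : smooth1 eps (fun s => (sigma \o inv c) (set_coord0 s z)).
  by apply: (smooth1_line oO _ sS) => s /lO[].
have : (halfopen eps (z ord0 ord0)).
  split=> //=; have [p dp pz] : (coord c @` dom c) z by rewrite imc.
  have [s [x [se bx dx pe]]] := c_dom dp.
  have [_ e] := c_eta se bx dx; rewrite -pz pe e set_coord00.
  by case/andP : se.
move=> Hz0; have := smooth1_linear lS _ _ Hz0.
rewrite /= set_coord0_same; apply.
  have [_ s0 _ _] := sigma_bdf; apply/s0; exact: line_bdry.
move=> s Us; rewrite (ds_line (sigma \o inv c) z s) -(cpd_inv ac imc) ?cpd0_sigma //.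
  by have [] := chart_imgP ac imc (lO _ Us).
exact: lO.
Qed.

Lemma cpd_sigma p i : dom c p -> cpd c i sigma p = (i == ord0)%:R.
Proof.
move=> dp; have Uz : cimg (coord c p) by rewrite /cimg -imc; exists p.
rewrite /cpd /pd; apply: (wderive_eq (half_space_dir_open oO)) => //.
have h : diff_quot (half_space (m := m)) (fun z : 'rV[R]_m.+1 => z ord0 ord0)
    (basis_dir R i) (coord c p) --> ((i == ord0)%:R : R).
  apply: (diff_quot_intro (u := fun=> (i == ord0)%:R)); first exact: cvg_cst.
  have := dir_nbhs_neq0 (half_space (m := m)) (basis_dir R i) (coord c p).
  apply: filterS => t t0; rewrite !mxE eqxx /= addrAC subrr add0r.
  by rewrite mulrA mulVf // mul1r eq_sym.
apply: (diff_quot_ext (half_space_dir_open oO) _ Uz h) => z.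
by rewrite inE => /sigma_coord0.
Qed.

Lemma ginv_adapted p i : dom c p ->
  ginv g c i ord0 p = norm2_d g c sigma p * (i == ord0)%:R.
Proof.
move=> dp; rewrite -grad_adapted // /grad (bigD1 ord0) //= big1 => [|j j0].
  by rewrite cpd_sigma // eqxx mulr1 addr0.
by rewrite cpd_sigma // (negbTE j0) mulr0.
Qed.

Definition slice_metric p : 'M[R]_m := row' ord0 (col' ord0 (g c p)).

(** The mixed components of the metric vanish together with those of its inverse,
    so the metric splits into the direction of [s] and the slices. *)
Lemma metric_adapted p : dom c p ->
  g c p ord0 ord0 = (norm2_d g c sigma p)^-1 /\
  \det (g c p) = (norm2_d g c sigma p)^-1 * \det (slice_metric p).
Proof.
move=> dp; apply: inv_block_col; first exact: (metric_unit g ac).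
by move=> i; exact: ginv_adapted.
Qed.

Lemma norm2_d_gt0 p : dom c p -> 0 < norm2_d g c sigma p.
Proof.
move=> dp; rewrite -invr_gt0; have [<- _] := metric_adapted dp.
exact/posdef00/(metric_posdef g ac).
Qed.

Lemma det_slice_gt0 p : dom c p -> 0 < \det (slice_metric p).
Proof. by move=> dp; exact/posdef_det_gt0/posdef_minor/(metric_posdef g ac). Qed.

Definition lapse p := Num.sqrt (norm2_d g c sigma p).
Definition slice_density p := Num.sqrt (\det (slice_metric p)).

Lemma lapse_gt0 p : dom c p -> 0 < lapse p.
Proof. by move=> dp; rewrite sqrtr_gt0 norm2_d_gt0. Qed.

Lemma slice_density_gt0 p : dom c p -> 0 < slice_density p.
Proof. by move=> dp; rewrite sqrtr_gt0 det_slice_gt0. Qed.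

Lemma sqr_lapse p : dom c p -> lapse p ^+ 2 = norm2_d g c sigma p.
Proof. by move=> dp; rewrite sqr_sqrtr // ltW // norm2_d_gt0. Qed.

Lemma smoothX_norm2_d : smoothX c O (norm2_d g c sigma).
Proof.
have h : smoothX c O (fun p => (g c p ord0 ord0)^-1).
  apply: (smooth_alongV (half_space_dir_open oO)); last exact: smoothX_metric.
  move=> z /(chart_imgP ac imc)[dz _].
  by rewrite gt_eqF // posdef00 //; exact: (metric_posdef g ac).
apply: (smooth_along_ext (half_space_dir_open oO) _ h) => z.
rewrite inE => /(chart_imgP ac imc)[dz _].
by have [e _] := metric_adapted dz; rewrite /= e invrK.
Qed.

Lemma smoothX_lapse : smoothX c O lapse.
Proof.
apply: (smooth_along_sqrt (half_space_dir_open oO)); last exact: smoothX_norm2_d.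
by move=> z /(chart_imgP ac imc)[dz _]; exact: norm2_d_gt0.
Qed.

Lemma smoothX_slice_density : smoothX c O slice_density.
Proof.
apply: (smooth_along_sqrt (half_space_dir_open oO)).
  by move=> z /(chart_imgP ac imc)[dz _]; exact: det_slice_gt0.
apply: (smooth_along_det (half_space_dir_open oO)) => i j.
have := smoothX_metric g ac oO imc (lift ord0 i) (lift ord0 j).
by apply: (smooth_along_ext (half_space_dir_open oO)) => z _; rewrite !mxE.
Qed.

(** Only the component 0 of the gradient is nonzero, and it is [lapse ^ 2]; the
    volume density is [slice_density / lapse]. *)
Lemma laplace_adapted p : dom c p ->
  laplace g c sigma p = lapse p / slice_density p *
    cpd c ord0 (fun q => lapse q * slice_density q) p.
Proof.
move=> dp.
have Uz : cimg (coord c p) by rewrite /cimg -imc; exists p.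
have oH := half_space_dir_open oO.
have dE q : dom c q -> sqrt_det g c q = slice_density q / lapse q.
  move=> dq; rewrite /sqrt_det; have [_ ->] := metric_adapted dq.
  by rewrite mulrC sqrtrM ?sqrtrV // ltW // ?norm2_d_gt0 ?det_slice_gt0.
rewrite /laplace /div dE // invf_div (bigD1 ord0) //= big1 ?addr0; last first.
  move=> i i0; rewrite /cpd /pd -(wderive_cst oH 0 i Uz).
  apply/esym; apply: (wderive_ext oH) => [z||]; rewrite ?inE //.
    move=> /(chart_imgP ac imc)[dz _].
    by rewrite /= grad_adapted // (negbTE i0) !mulr0.
  exact/smooth_along_diff/(smooth_along_cst oH).
congr (_ * _); rewrite /cpd /pd; apply/esym.
apply: (wderive_ext oH) => [z||]; rewrite ?inE //.
  move=> /(chart_imgP ac imc)[dz _] /=.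
  rewrite grad_adapted // eqxx mulr1 dE // -sqr_lapse //.
  by field; rewrite gt_eqF // lapse_gt0.
apply: smooth_along_diff; apply: (smooth_alongM oH).
  exact: smoothX_lapse.
exact: smoothX_slice_density.
Qed.

(** In the coordinates [c0] and [c], the map [eta s] between the boundary and a
    slice is the identity on tangential coordinates, so its Jacobian selects the
    tangential block of the metric.  The derivatives in the definition of the
    pull-back run through boundary points only, where [f] is known. *)
Lemma pullback_slice s (f : X -> X) (h : chart R m X -> X -> 'M[R]_m) x :
  is_pullback g f h -> boundary mX x -> dom c0 x ->
  (forall q, boundary mX q -> dom c0 q ->
     dom c (f q) /\ coord c (f q) = set_coord0 s (coord c0 q)) ->
  h c0 x = slice_metric (f x).
Proof.
move=> hf bx dx fc.
have [dfx cfx] := fc _ bx dx.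
rewrite (hf c0 c x) //.
have [U0 oU0 im0] := chart_open ac0.
set D := \matrix_(i, a) _.
have DE i a : D i a = (a == lift ord0 i)%:R.
  rewrite mxE /cpd /pd.
  have x0 := boundary_coord0 sigma_bdf ac0 dx bx.
  have Uz : (half_space (m := m) `&` U0) (coord c0 x) by rewrite -im0; exists x.
  apply: (wderive_eq (half_space_dir_open oU0)) => //.
  apply: (diff_quot_intro (u := fun=> (a == lift ord0 i)%:R)); first exact: cvg_cst.
  have [_] := half_space_dir_open oU0 (lift ord0 i) Uz.
  have := dir_nbhs_neq0 (half_space (m := m)) (basis_dir R (lift ord0 i)) (coord c0 x).
  apply: filterS2 => t t0; rewrite -im0 => -[q dq qt].
  rewrite /= -qt !(inv_coord ac0) //.
  have bq : boundary mX q.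
    by exists c0; rewrite // qt !mxE x0 /= add0r mulr0.
  have [_ ->] := fc _ bq dq; rewrite cfx qt !mxE.
  case: (unliftP ord0 a) => [b ->|->] /=; last by rewrite subrr mulr0.
  by rewrite addrAC subrr add0r mulrA mulVf // mul1r.
apply/matrixP => i j; rewrite !mxE (bigD1 (lift ord0 j)) //= big1 => [|b bj].
  rewrite [D^T _ _]mxE DE eqxx mulr1 addr0 [(D *m _) _ _]mxE.
  rewrite (bigD1 (lift ord0 i)) //= big1 => [|b bi].
    by rewrite DE eqxx mul1r addr0.
  by rewrite DE (negbTE bi) mul0r.
by rewrite [D^T _ _]mxE DE (negbTE bj) mulr0.
Qed.

Section Curve.
Variable x : X.
Hypotheses (bx : boundary mX x) (dx : dom c0 x).

Let lapse_curve s := lapse (eta s x).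
Let density_curve s := slice_density (eta s x).

Lemma halfopen_itv s : halfopen eps s -> 0 <= s < eps.
Proof. by move=> [s0 s1]; apply/andP; split. Qed.

Lemma curve_dom s : halfopen eps s -> dom c (eta s x).
Proof. by move=> /halfopen_itv se; have [] := c_eta se bx dx. Qed.

Lemma curve_inv s : halfopen eps s ->
  inv c (set_coord0 s (coord c0 x)) = eta s x.
Proof.
by move=> /halfopen_itv se; have [d <-] := c_eta se bx dx; exact: (inv_coord ac).
Qed.

Lemma curve_img s : halfopen eps s -> cimg (set_coord0 s (coord c0 x)).
Proof.
move=> /halfopen_itv se; have [d <-] := c_eta se bx dx.
by rewrite /cimg -imc; exists (eta s x).
Qed.

Lemma smooth1_curve f : smoothX c O f -> smooth1 eps (fun s => f (eta s x)).
Proof.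
move=> fS.
have lO s : halfopen eps s -> O (set_coord0 s (coord c0 x)).
  by move=> /curve_img[].
have := smooth1_line oO lO fS.
apply: (smooth_along_ext (halfopen_dir_open eps)) => s.
by rewrite inE => Us; rewrite /= curve_inv.
Qed.

Lemma ds_curve f s : smoothX c O f -> halfopen eps s ->
  ds (fun u => f (eta u x)) s = cpd c ord0 f (eta s x).
Proof.
move=> fS Us; rewrite -curve_inv // (cpd_inv ac imc); last exact: curve_img.
rewrite -(ds_line (f \o inv c)); apply: (@ds_ext _ eps); rewrite ?inE //.
  by move=> u; rewrite inE => Uu; rewrite /= curve_inv.
exact: smooth1_curve.
Qed.

Lemma sigma_curve s : halfopen eps s -> sigma (eta s x) = s.
Proof.
move=> Us; rewrite -curve_inv // sigma_coord0; last exact: curve_img.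
by rewrite set_coord00.
Qed.

Lemma density_curve_neq0 s : halfopen eps s -> density_curve s != 0.
Proof. by move=> /curve_dom d; rewrite gt_eqF // slice_density_gt0. Qed.

Lemma smooth1_lapse : smooth1 eps lapse_curve.
Proof. exact/smooth1_curve/smoothX_lapse. Qed.

Lemma smooth1_density : smooth1 eps density_curve.
Proof. exact/smooth1_curve/smoothX_slice_density. Qed.

Lemma smooth1_inv_density : smooth1 eps (fun s => (density_curve s)^-1).
Proof.
apply: (smooth_alongV (halfopen_dir_open eps)) smooth1_density.
exact: density_curve_neq0.
Qed.

Lemma laplace_curve s : halfopen eps s ->
  laplace g c sigma (eta s x) = lapse_curve s / density_curve s *
    ds (fun u => lapse_curve u * density_curve u) s.
Proof.
move=> Us; rewrite laplace_adapted; last exact: curve_dom.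
rewrite -(ds_curve (f := fun p => lapse p * slice_density p)) //.
apply: (smooth_alongM (half_space_dir_open oO)).
  exact: smoothX_lapse.
exact: smoothX_slice_density.
Qed.

(** The volume ratio does not depend on coordinates, and both volume densities
    are computed in [c0]. *)
Lemma volume_ratio_curve (h : chart R m X -> X -> 'M[R]_m)
    (hs : R -> chart R m X -> X -> 'M[R]_m) (v : R -> X -> R) s :
  is_pullback g id h ->
  (forall s, 0 <= s < eps -> is_pullback g (eta s) (hs s)) ->
  (forall s, 0 <= s < eps -> is_volume_ratio mX (hs s) h (v s)) ->
  halfopen eps s -> v s x = density_curve s / density_curve 0.
Proof.
move=> h_def hs_def v_def /halfopen_itv se; rewrite (v_def s se c0 x) //.
rewrite (pullback_slice (s := s) (hs_def s se)) //; last first.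
  by move=> q bq dq; exact: c_eta.
rewrite (pullback_slice (s := 0) h_def) //; last first.
  by move=> q bq dq; rewrite -{1 2}(eta0 bq); apply: c_eta; rewrite // lexx.
by rewrite /density_curve eta0.
Qed.

(** Condition (SY) holds near the boundary only, hence the smaller interval; the
    remainder is smooth on the part of the chart domain where it is controlled,
    which corresponds to a relatively open part of the half-space. *)
Lemma SY_curve rho : condition_SY g sigma rho -> exists d T,
  [/\ 0 < d, d <= eps, smooth1 d T & forall s, halfopen d s ->
    lapse_curve s ^+ 2 + 2 * s * rho (eta s x) = 1 + s ^+ m.+1 * T s].
Proof.
move=> [N2 N2E [W [Rn [oW bW RnS SYE]]]].
have [V oV VE] := chart_preimage_open ac oW.
have oUV : open (O `&` V) by exact: openI.
have RnV : smoothH (O `&` V) (Rn \o inv c).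
  by apply: smooth_on_smoothH => //; rewrite setIA -imc -VE; exact: RnS.
have WV s : halfopen eps s -> W (eta s x) -> V (set_coord0 s (coord c0 x)).
  move=> Us Ws.
  have : (coord c @` (dom c `&` W)) (set_coord0 s (coord c0 x)).
    have [d <-] := c_eta (halfopen_itv Us) bx dx.
    by exists (eta s x).
  by rewrite VE => -[].
have VW s : halfopen eps s -> V (set_coord0 s (coord c0 x)) -> W (eta s x).
  move=> Us Vs.
  have : (coord c @` dom c `&` V) (set_coord0 s (coord c0 x)).
    by rewrite imc; split=> //; exact: curve_img.
  by rewrite -VE => -[p [dp Wp] pe]; rewrite -curve_inv // -pe (inv_coord ac).
have V0 : V (set_coord0 0 (coord c0 x)).
  by apply: WV; [exact: halfopen0|rewrite eta0 //; exact: bW].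
have line0 :
    set_coord0 s (coord c0 x) @[s --> (0 : R)] --> set_coord0 0 (coord c0 x).
  by apply: set_coord0_cvg; [exact: cvg_id|exact: cvg_cst].
have /nbhs_ballP[e /= e0 eV] := line0 V (open_nbhs_nbhs (conj oV V0)).
pose d := Num.min e eps.
have deps : d <= eps by rewrite ge_min lexx orbT.
have Ud s : halfopen d s -> halfopen eps s.
  by move=> [s0 sd]; split=> //; exact: lt_le_trans deps.
have Vd s : halfopen d s -> V (set_coord0 s (coord c0 x)).
  move=> [s0]; rewrite /= lt_min => /andP[se _]; apply: eV.
  by rewrite /ball /= sub0r normrN ger0_norm.
exists d, (fun s => Rn (eta s x)); split=> //.
- by rewrite lt_min e0.
- have lUV s : halfopen d s -> (O `&` V) (set_coord0 s (coord c0 x)).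
    by move=> Us; split; [have [] := curve_img (Ud _ Us)|exact: Vd].
  have := smooth1_line oUV lUV RnV.
  apply: (smooth_along_ext (halfopen_dir_open d)) => s; rewrite inE => Us.
  by rewrite /= curve_inv //; exact: Ud.
- move=> s Us; have Us' := Ud _ Us; have ds := curve_dom Us'.
  have := SYE _ (VW _ Us' (Vd _ Us)).
  by rewrite (N2E c _ ac ds) sigma_curve // sqr_lapse.
Qed.

End Curve.

End AdaptedGeometry.

(** * The recursion for the derivatives of rho *)

Theorem proposition6p4 (R : realType) (n : nat) (X : topologicalType)
    (mX : bmanifold R n X) (g : metric mX)
    (X_compact : compact [set: X]) (X_hausdorff : hausdorff_space X)
    (sigma J rho : X -> R)
    (sigma_bdf : boundary_defining mX sigma)
    (J_def : is_schouten_trace g J)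
    (rho_def : is_rho g sigma J rho)
    (SY : condition_SY g sigma rho)
    (eps : R) (eta : R -> X -> X)
    (eta_adapted : adapted_coordinates g sigma eps eta)
    (h : chart R n X -> X -> 'M[R]_n) (h_def : is_pullback g id h)
    (hs : R -> chart R n X -> X -> 'M[R]_n)
    (hs_def : forall s, 0 <= s < eps -> is_pullback g (eta s) (hs s))
    (v : R -> X -> R)
    (v_def : forall s, 0 <= s < eps -> is_volume_ratio mX (hs s) h (v s))
    (x : X) (Mx : boundary mX x) (k : nat) (hk : (1 <= k <= n.-1)%N) :
  let rhox := fun s => rho (eta s x) in
  let Jx := fun s => J (eta s x) in
  let w := fun s => ds (fun u => v u x) s / v s x in
  (n%:R - k%:R) * iter k (@ds R) rhox 0 =
    - iter k (@ds R) w 0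
    + 2 * (\sum_(1 <= j < k.+1)
             j%:R * 'C(k, j)%:R * iter j.-1 (@ds R) rhox 0
             * iter (k - j) (@ds R) w 0)
    - k%:R * iter k.-1 (@ds R) Jx 0.
Proof.
move=> rhox Jx w.
have [c0 ac0 dx] := atlas_cover mX x.
have [c ad] := adapted_chart_exists sigma_bdf eta_adapted ac0.
have ac := adapted_atlas ad; have eps0 := adapted_eps_gt0 ad.
have [U oU imc] := chart_open ac.
pose al s := lapse g sigma c (eta s x).
pose be s := slice_density g c (eta s x).
have alS : smooth1 eps al := smooth1_lapse sigma_bdf ad oU imc Mx dx.
have beS : smooth1 eps be := smooth1_density ad oU imc Mx dx.
have beVS : smooth1 eps (fun s => (be s)^-1).
  exact: (smooth1_inv_density ad oU imc Mx dx).
have be0 s : halfopen eps s -> be s != 0.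
  exact: (density_curve_neq0 ad Mx dx).
have dc s : halfopen eps s -> dom c (eta s x) by exact: (curve_dom ad Mx dx).
have JS : smooth1 eps Jx.
  have scalS := smooth1_curve ad oU imc Mx dx (smoothX_scal g ac oU imc).
  have := smooth1M (smooth1_cst eps (2 * n%:R)^-1) scalS.
  apply: (smooth_along_ext (halfopen_dir_open eps)) => s; rewrite inE => Us.
  rewrite -(J_def c _ ac (dc _ Us)) mulKf // mulf_neq0 ?pnatr_eq0 //.
  by case: (n) hk => //=; case: (k).
pose L s := al s / be s * ds (fun u => al u * be u) s.
have rhoE s : halfopen eps s -> n.+1%:R * rhox s = - L s - s * Jx s.
  move=> Us; have [La LaE ->] := rho_def.
  rewrite (sigma_curve sigma_bdf ad oU imc Mx dx) // (LaE c _ ac (dc _ Us)).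
  by rewrite (laplace_curve sigma_bdf ad oU imc Mx dx).
have rhoS : smooth1 eps rhox.
  have LS : smooth1 eps L.
    apply: smooth1M; last exact/smooth1_ds/smooth1M.
    exact: smooth1M.
  have h1 : smooth1 eps (fun s => n.+1%:R^-1 * ((-1) * L s + (-1) * (s * Jx s))).
    apply: smooth1M; first exact: smooth1_cst.
    apply: smooth1D; apply: smooth1M => //; try exact: smooth1_cst.
    by apply: smooth1M => //; exact: smooth1_id.
  apply: (smooth_along_ext (halfopen_dir_open eps) _ h1) => s; rewrite inE => Us.
  by rewrite !mulN1r -rhoE // mulKf // pnatr_eq0.
have vE s : halfopen eps s -> v s x = be s / be 0.
  exact: (volume_ratio_curve sigma_bdf ad Mx dx h_def hs_def v_def).
have wE s : halfopen eps s -> w s = ds be s / be s.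
  move=> Us; rewrite /w vE //.
  have -> : ds (fun u => v u x) s = ds be s / be 0.
    rewrite -(@ds_ext _ eps (fun u => be u / be 0)) ?inE //; last 2 first.
    - by move=> u; rewrite inE => Uu; rewrite vE.
    - by apply: smooth1M => //; exact: smooth1_cst.
    rewrite (dsM beS (smooth1_cst eps _) Us) (@ds_cst _ eps) //.
    by rewrite mulr0 addr0.
  by field; rewrite !be0 //; exact: halfopen0.
have wS : smooth1 eps w.
  have h1 : smooth1 eps (fun s => ds be s / be s).
    by apply: smooth1M => //; exact: smooth1_ds.
  apply: (smooth_along_ext (halfopen_dir_open eps) _ h1) => s; rewrite inE => Us.
  by rewrite wE.
have [d [T [d0 deps TS SYE]]] := SY_curve sigma_bdf ad oU imc Mx dx SY.
have le1 f : smooth1 eps f -> smooth1 d f by exact: smooth1_le.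
apply: (@iterated_identity R d n k rhox Jx w T) => //; [exact: le1..|].
move=> s Us; have Us' : halfopen eps s.
  by have [s0 sd] := Us; split=> //; exact: lt_le_trans deps.
apply: (first_order_identity (le1 _ alS) (le1 _ beS) (le1 _ rhoS) TS SYE Us);
  [exact: be0|exact: rhoE|exact: wE].
Qed.
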